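(* Consider Radix Selection with a general Markov source for which there is no $\beta>0$ such that $$p_{0r}=p_{1r}=\cdots=p_{(b-1)r}=\frac{1-\beta}{1-\beta^b}\beta^r\quad\text{for all }r\in\Sigma$$ (where for $\beta=1$ the right-hand side is read as $1/b$). Then, for all $0\le c<d\le1$, the sequence of distributions of $\mathcal Y_n$, $n\ge1$, considered on $\mathrm D([c,d])$, is not tight, where $$\mathcal Y_n(t)=\frac{Y_n(\lfloor tn\rfloor+1)-m(h(t))\,n}{\sqrt n},\quad t\in[0,1].$$
   Context: Let $b\ge 2$ be an integer, $\Sigma=\{0,\ldots,b-1\}$, $\Sigma^\infty$ the set of infinite strings over $\Sigma$, and $\Sigma^*=\bigcup_{n\ge 0}\Sigma^n$ with $\Sigma^0=\{\emptyset\}$. Markov source: a homogeneous Markov chain on $\Sigma$ with initial distribution $\mu=(\mu_r)_{r\in\Sigma}$ and transition matrix $(p_{ij})_{i,j\in\Sigma}$, where always $0<\mu_i,p_{ij}<1$ for all $i,j\in\Sigma$. $S_1,S_2,\ldots$ are independent infinite strings, each generated by this chain. For $v,w\in\Sigma^\infty$, $j(v,w)=\max\{i\ge 0:(v_1,\ldots,v_i)=(w_1,\ldots,w_i)\}$ ($=\infty$ if $v=w$); $v<w$ means $v_{j(v,w)+1}<w_{j(v,w)+1}$ (lexicographic order), $v\le w$ means $v<w$ or $v=w$. $S_{(1)}<\cdots<S_{(n)}$ are the order statistics of $S_1,\ldots,S_n$ (a.s. distinct). $\Lambda_{n,k}(v)=\#\{1\le i\le n: j(v,S_i)\ge k\}$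 for $k\ge0$; $Z_n(v)=\sum_{k\ge 0}\Lambda_{n,k}(v)\mathbf 1_{\{\Lambda_{n,k}(v)>1\}}$ for $v\in\Sigma^\infty$; $Y_n(\ell)=Z_n(S_{(\ell)})$ for $1\le\ell\le n$ (the number of bucket operations Radix Selection needs to retrieve rank $\ell$), and $Y_n(n+1):=Y_n(n)$. For $v=v_1\ldots v_k\in\Sigma^*$ with $k\ge1$, $\pi(v)=\mu_{v_1}p_{v_1v_2}\cdots p_{v_{k-1}v_k}$, and $\pi(\emptyset)=1$. $m(w)=\sum_{v\preceq w,\,v\in\Sigma^*}\pi(v)$ (sum over finite prefixes $v$ of $w$) and $F(w)=\mathbb P(S_1\le w)$ for $w\in\Sigma^\infty$; $h(t)=\sup\{v\in\Sigma^\infty:F(v)\le t\}$ for $t\in[0,1]$ (supremum in lexicographic order). $\mathrm D([c,d])$ is the space of real-valued càdlàg functions on $[c,d]$ with Skorokhod's $J_1$-topology. *)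

(* Defs.v *)
From HB Require Import structures.
From mathcomp Require Import all_boot all_order all_algebra.
From mathcomp Require Import all_classical all_reals all_analysis.

Set Implicit Arguments.
Unset Strict Implicit.
Unset Printing Implicit Defensive.
Import Order.TTheory GRing.Theory Num.Theory.
Import numFieldNormedType.Exports.
Local Open Scope classical_set_scope.
Local Open Scope ring_scope.

(** * Infinite strings and the lexicographic order *)

(* Positions are counted from 0: the symbol [v_i] of the mathematical notation
   (i >= 1) is [v i.-1], and the prefix (v_1, ..., v_i) is [mkseq v i].
   The alias carries the lexicographic order (not the pointwise one). *)
Definition istring (b : nat) : Type := nat -> 'I_b.

HB.instance Definition _ (b : nat) := Choice.copy (istring b) (nat -> 'I_b).

Section strings.
Variable b : nat.
Implicit Types u v w : istring b.

(* [None] stands for infinity. *)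
Definition lcp v w : option nat :=
  if v == w then None
  else Some (xget 0%N [set i | mkseq v i = mkseq w i /\
                        forall k, mkseq v k = mkseq w k -> (k <= i)%N]).

Definition lcp_ge k v w : bool :=
  if lcp v w is Some i then (k <= i)%N else true.

Definition lexlt v w : bool :=
  if lcp v w is Some i then (v i < w i)%N else false.

Lemma mkseq_eqP v w i :
  mkseq v i = mkseq w i <-> forall k, (k < i)%N -> v k = w k.
Proof.
split=> [vw k ki|vw]; last first.
  by apply/eq_in_map => k; rewrite mem_iota add0n => /vw.
by rewrite -(nth_mkseq (v 0%N) v ki) -(nth_mkseq (v 0%N) w ki) vw.
Qed.

Variant lcp_spec v w : option nat -> Prop :=
| LcpNone of v = w : lcp_spec v w None
| LcpSome i of (forall k, (k < i)%N -> v k = w k) & v i != w i :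
    lcp_spec v w (Some i).

Lemma lcpP v w : lcp_spec v w (lcp v w).
Proof.
rewrite /lcp; case: eqVneq => [vw|vw]; first exact: LcpNone.
have exd : exists i, v i != w i.
  apply: contrapT => /forallNP nd; move/eqP: vw; apply.
  by apply/funext => i; move/negP: (nd i); rewrite negbK => /eqP.
have [i vwi mini] := ex_minnP exd.
have eqlt k : (k < i)%N -> v k = w k.
  by move=> ki; apply/eqP; apply: contraTT ki => /mini; rewrite -leqNgt.
have maxi k : mkseq v k = mkseq w k -> (k <= i)%N.
  move=> /mkseq_eqP vwk; rewrite leqNgt; apply/negP => /vwk /eqP.
  exact/negP.
case: xgetP => [j _ [/mkseq_eqP vwj maxj]|/(_ i)[]]; last first.
  by split; [exact/mkseq_eqP|exact: maxi].
suff -> : j = i by exact: LcpSome.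
by apply/eqP; rewrite eqn_leq maxi ?maxj//; exact/mkseq_eqP.
Qed.

Lemma lexltP v w : reflect
  (exists2 i, forall k, (k < i)%N -> v k = w k & (v i < w i)%N) (lexlt v w).
Proof.
apply: (iffP idP) => [|[i vwi vi]]; rewrite /lexlt.
  by case: lcpP => // i vwi _ vi; exists i.
case: lcpP => [vw|j vwj nvw]; first by move: vi; rewrite vw ltnn.
have [ij|ji|<-//] := ltngtP i j.
  by move: vi; rewrite vwj// ltnn.
by move: nvw; rewrite vwi// eqxx.
Qed.

Lemma lexlt_irr : irreflexive lexlt.
Proof. by move=> v; apply/negP => /lexltP[i _]; rewrite ltnn. Qed.

Lemma lexlt_trans : transitive lexlt.
Proof.
move=> v u w /lexltP[i uvi uv] /lexltP[j vwj vw]; apply/lexltP.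
have [ij|ji|ij] := ltngtP i j.
- exists i => [k ki|]; first by rewrite uvi// vwj// (ltn_trans ki).
  by rewrite -vwj.
- exists j => [k kj|]; first by rewrite uvi ?vwj// (ltn_trans kj).
  by rewrite uvi.
- subst j; exists i => [k ki|]; first by rewrite uvi ?vwj.
  exact: ltn_trans vw.
Qed.

Definition lexle v w : bool := (v == w) || lexlt v w.

Lemma lexle_total : total lexle.
Proof.
move=> v w; rewrite /lexle; have [->|nvw] := eqVneq v w; first by [].
rewrite /=; case: (lcpP v w) => [vw|i vwi nvi]; first by rewrite vw eqxx in nvw.
have [vi|wi|vi] := ltngtP (v i) (w i).
- by apply/orP; left; apply/lexltP; exists i.
- apply/orP; right; apply/lexltP.
  by exists i => // k ki; rewrite vwi.
- by move: nvi; rewrite (val_inj vi) eqxx.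
Qed.

End strings.

Fact lexi_display : Order.disp_t. Proof. exact: Order.Disp tt tt. Qed.

HB.instance Definition _ (b : nat) := Order.LtLe_isPOrder.Build lexi_display
  (istring b) (fun v w => erefl (lexle v w)) (@lexlt_irr b) (@lexlt_trans b).
HB.instance Definition _ (b : nat) :=
  Order.POrder_isTotal.Build lexi_display (istring b) (@lexle_total b).

Lemma istring_leE b (v w : istring b) : (v <= w)%O = (v == w) || lexlt v w.
Proof. by []. Qed.

Lemma istring_ltE b (v w : istring b) : (v < w)%O = lexlt v w.
Proof. by []. Qed.

(** * Markov sources *)

Section markov_source.
Context (R : realType) (b : nat).
Implicit Types (mu : 'I_b -> R) (p : 'I_b -> 'I_b -> R).

Definition source_params mu p : Prop :=
  [/\ forall i, 0 < mu i < 1, \sum_i mu i = 1,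
      forall i j, 0 < p i j < 1 & forall i, \sum_j p i j = 1].

Definition geometric_rows p (beta : R) : Prop :=
  forall i r, p i r =
    if beta == 1 then b%:R^-1
    else (1 - beta) / (1 - beta ^+ b) * beta ^+ r.

Context d (Omega : measurableType d) (P : probability Omega R).

Definition is_markov_chain mu p (X : Omega -> istring b) : Prop :=
  [/\ forall k r, measurable [set om | X om k = r],
      forall r, P [set om | X om 0%N = r] = (mu r)%:E
    & forall k (v : istring b),
        (P [set om | mkseq (X om) k.+2 = mkseq v k.+2] =
         P [set om | mkseq (X om) k.+1 = mkseq v k.+1] * (p (v k) (v k.+1))%:E)%E].

Definition string_events : set (set (istring b)) :=
  <<s [set A | exists k r, A = [set w : istring b | w k = r]] >>.

Definition independent_strings (S : nat -> Omega -> istring b) : Prop :=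
  forall (J : seq nat) (A : nat -> set (istring b)), uniq J ->
    (forall i, i \in J -> string_events (A i)) ->
    (P (\big[setI/setT]_(i <- J) (S i @^-1` A i)) =
     \prod_(i <- J) P (S i @^-1` A i))%E.

End markov_source.

(** * Radix Selection *)

Section radix.
Context (R : realType) (b : nat).

Section sample.
(* [s i] is the string S_{i+1}. *)
Variable s : nat -> istring b.

Definition Lambda (n k : nat) (v : istring b) : nat :=
  count (lcp_ge k v) (mkseq s n).

Definition Zn (n : nat) (v : istring b) : \bar R :=
  (\sum_(0 <= k <oo)
    (if (1 < Lambda n k v)%N then ((Lambda n k v)%:R)%:E else 0))%E.

Definition order_stat (n l : nat) : istring b :=
  nth (s 0%N) (sort <=%O (mkseq s n)) l.-1.

(* [Zn] is infinite only when two of the strings coincide, a null event on which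
   [fine] returns 0. *)
Definition Yn (n l : nat) : R :=
  fine (Zn n (order_stat n (if l == n.+1 then n else l))).

End sample.

Definition word_prob (mu : 'I_b -> R) (p : 'I_b -> 'I_b -> R)
    (v : seq 'I_b) : R :=
  if v is r :: v' then mu r * \prod_(x <- pairmap p r v') x else 1.

Definition m_fun (mu : 'I_b -> R) (p : 'I_b -> 'I_b -> R) (w : istring b) : R :=
  limn (series (fun k => word_prob mu p (mkseq w k))).

(* The set below contains 000... for every t in [0, 1] and has a supremum;
   the default value of [supremum] is never used. *)
Definition h_fun (b_gt1 : (1 < b)%N) (F : istring b -> R) (t : R) : istring b :=
  supremum ((fun=> Ordinal (ltnW b_gt1)) : istring b)
    [set v : istring b | F v <= t].

Context d (Omega : measurableType d) (P : probability Omega R).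

Definition cdf (X : Omega -> istring b) (w : istring b) : R :=
  fine (P [set om | (X om <= w)%O]).

Definition calY (b_gt1 : (1 < b)%N) mu p (S : nat -> Omega -> istring b)
    (n : nat) (om : Omega) (t : R) : R :=
  (Yn (S^~ om) n (Num.truncn (t * n%:R)).+1
   - m_fun mu p (h_fun b_gt1 (cdf (S 0%N)) t) * n%:R) / Num.sqrt n%:R.

End radix.

(** * The space D([c, d]) with the J1 topology *)

Section skorokhod.
Context (R : realType) (c d : R).

Definition cadlag (f : R -> R) : Prop :=
  (forall t, c <= t < d -> f x @[x --> t^'+] --> f t) /\
  (forall t, c < t <= d -> cvg (f x @[x --> t^'-])).

(* A function on [c, d] is represented by its extension by 0 to the line. *)
Record skorokhod := Skorokhod {
  sk_fun :> R -> R ;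
  _ : `[< cadlag sk_fun /\ forall t, t \notin `[c, d] -> sk_fun t = 0 >] }.

HB.instance Definition _ := [isSub for sk_fun].
HB.instance Definition _ := [Choice of skorokhod by <:].

Lemma sk0_subproof :
  `[< cadlag (fun=> 0) /\ forall t : R, t \notin `[c, d] -> (0 : R) = 0 >].
Proof.
by apply/asboolP; split=> //; split=> t _; [exact: cvg_cst|exact: is_cvg_cst].
Qed.

Definition sk0 : skorokhod := Skorokhod sk0_subproof.

(* The element of D([c, d]) given by the restriction of f to [c, d]; the value
   is [sk0] only for f that are not cadlag on [c, d]. *)
Definition to_skorokhod (f : R -> R) : skorokhod :=
  insubd sk0 (fun t => if t \in `[c, d] then f t else 0).

Lemma to_skorokhodE (f : R -> R) : cadlag f ->
  forall t, t \in `[c, d] -> to_skorokhod f t = f t.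
Proof.
move=> [fr fl] t tcd; pose g u := if u \in `[c, d] then f u else 0.
have gE u : c <= u <= d -> g u = f u by rewrite /g in_itv/= => ->.
have gcadlag : cadlag g.
  split=> u /andP[cu ud].
    rewrite gE ?cu ?ltW//; apply: cvg_trans (fr _ _); last by rewrite cu.
    apply: near_eq_cvg; near=> x; rewrite gE//.
    apply/andP; split; first by rewrite (le_trans cu).
    by near: x; exact: nbhs_right_le.
  have /fl/cvg_ex[l fxl] : c < u <= d by rewrite cu.
  apply/cvg_ex; exists l; apply: cvg_trans fxl.
  apply: near_eq_cvg; near=> x; rewrite gE//.
  apply/andP; split; last by rewrite (le_trans _ ud).
  by near: x; exact: nbhs_left_ge.
have gP : `[< cadlag g /\ forall u, u \notin `[c, d] -> g u = 0 >].
  by apply/asboolP; split=> // u; rewrite /g => /negbTE ->.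
have := @insubdK _ _ skorokhod sk0 g gP; rewrite /to_skorokhod -/g.
by move=> /(congr1 (fun k => k t)) /= ->; rewrite /g tcd.
Unshelve. all: by end_near. Qed.

Definition time_change (lam : R -> R) : Prop :=
  [/\ {in `[c, d] &, {homo lam : x y / x < y}},
      lam @` `[c, d]%classic = `[c, d]%classic
    & {within `[c, d], continuous lam}].

(* Open balls of the metric
     inf_lam max (sup_t |lam t - t|, sup_t |x t - y (lam t)|)
   which generates the J1 topology. *)
Definition sk_ball (x : skorokhod) (e : R) (y : skorokhod) : Prop :=
  exists2 e', e' < e & exists2 lam, time_change lam &
    forall t, t \in `[c, d] -> `|lam t - t| <= e' /\ `|x t - y (lam t)| <= e'.

Lemma time_change_id : time_change id.
Proof.
split; first by [].
  by rewrite image_id.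
by apply: continuous_subspaceT => x; exact: cvg_id.
Qed.

Lemma time_change_in lam t : time_change lam ->
  t \in `[c, d] -> lam t \in `[c, d].
Proof.
by move=> [_ im _] tcd; have : (lam @` `[c, d]%classic) (lam t);
  [exists t|rewrite im].
Qed.

Lemma time_changeP lam : {in `[c, d] &, {homo lam : x y / x < y}} ->
  lam @` `[c, d]%classic = `[c, d]%classic -> time_change lam.
Proof.
move=> hom im; split => //.
have [cd|dc] := leP c d; last first.
  by rewrite set_itv_ge ?bnd_simp -?ltNge//; exact: continuous_subspace0.
have ccd : c \in `[c, d] by rewrite in_itv/= lexx.
have dcd : d \in `[c, d] by rewrite in_itv/= lexx cd.
have lam_in t : t \in `[c, d] -> lam t \in `[c, d].
  by move=> tcd; have : (lam @` `[c, d]%classic) (lam t);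
    [exists t|rewrite im].
have monle : {in `[c, d] &, {mono lam : x y / x <= y}} by exact: le_mono_in.
have lamc : lam c = c.
  apply/eqP; rewrite eq_le; have := lam_in _ ccd.
  rewrite in_itv/= => /andP[-> _]; rewrite andbT.
  have : (lam @` `[c, d]%classic) c by rewrite im.
  by move=> [t tcd lt]; rewrite -[leRHS]lt monle//;
    move: tcd; rewrite /= in_itv/= => /andP[].
have lamd : lam d = d.
  apply/eqP; rewrite eq_le; have := lam_in _ dcd.
  rewrite in_itv/= => /andP[_ ->]/=.
  have : (lam @` `[c, d]%classic) d by rewrite im.
  by move=> [t tcd lt]; rewrite -[leLHS]lt monle//;
    move: tcd; rewrite /= in_itv/= => /andP[].
apply: segment_inc_surj_continuous => //.
by rewrite lamc lamd => t tcd; rewrite im.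
Qed.

Lemma time_change_inv lam : time_change lam ->
  exists2 lam', time_change lam' &
    forall t, t \in `[c, d] -> lam (lam' t) = t.
Proof.
move=> tc; have [hom im _] := tc.
have ex t : exists u, t \in `[c, d] -> u \in `[c, d] /\ lam u = t.
  have [tcd|_] := boolP (t \in `[c, d]); last by exists t.
  have : (lam @` `[c, d]%classic) t by rewrite im.
  by move=> [u ucd <-]; exists u.
have [lam' lam'P] := choice ex.
have lamK t : t \in `[c, d] -> lam (lam' t) = t by move=> /lam'P[].
have lam'_in t : t \in `[c, d] -> lam' t \in `[c, d] by move=> /lam'P[].
have lam'K t : t \in `[c, d] -> lam' (lam t) = t.
  move=> tcd; have ltcd := time_change_in tc tcd.
  apply: (inc_inj_in (le_mono_in hom)) => //; first exact: lam'_in.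
  by rewrite lamK.
exists lam' => //; apply: time_changeP.
  move=> x y xcd ycd xy.
  by rewrite -(leW_mono_in (le_mono_in hom)) ?lam'_in// !lamK.
apply/seteqP; split => [_ [t tcd <-]|t tcd]; first exact: lam'_in.
by exists (lam t); [exact: time_change_in|exact: lam'K].
Qed.

Lemma sk_ball_center x (e : R) : 0 < e -> sk_ball x e x.
Proof.
move=> e0; exists 0 => //; exists id; first exact: time_change_id.
by move=> t _; rewrite !subrr normr0.
Qed.

Lemma sk_ball_sym x y (e : R) : sk_ball x e y -> sk_ball y e x.
Proof.
move=> [e' e'e [lam tc xy]]; have [lam' tc' lamK] := time_change_inv tc.
exists e' => //; exists lam' => // t tcd.
have [] := xy _ (time_change_in tc' tcd); rewrite lamK// => tl xyt.
by rewrite distrC tl distrC.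
Qed.

Lemma sk_ball_triangle x y z (e1 e2 : R) :
  sk_ball x e1 y -> sk_ball y e2 z -> sk_ball x (e1 + e2) z.
Proof.
move=> [e1' e1e [l1 tc1 xy]] [e2' e2e [l2 tc2 yz]].
exists (e1' + e2'); first exact: ltrD.
exists (l2 \o l1).
  have [hom1 im1 _] := tc1; have [hom2 im2 _] := tc2; apply: time_changeP.
    by move=> u v ucd vcd uv /=; rewrite hom2 ?hom1// time_change_in.
  by rewrite -image_comp im1 im2.
move=> t tcd /=; have [lt1 xt] := xy _ tcd.
have [lt2 yt] := yz _ (time_change_in tc1 tcd); split.
- rewrite -(subrK (l1 t) (l2 _)) -addrA (le_trans (ler_normD _ _))//.
  by rewrite [leRHS]addrC lerD.
- rewrite -(subrK (y (l1 t)) (x t)) -addrA (le_trans (ler_normD _ _))//.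
  exact: lerD.
Qed.

HB.instance Definition _ := isPointed.Build skorokhod sk0.
HB.instance Definition _ := hasNbhs.Build skorokhod (nbhs_ (entourage_ sk_ball)).
HB.instance Definition _ := Nbhs_isPseudoMetric.Build R skorokhod
  erefl sk_ball_center sk_ball_sym sk_ball_triangle erefl.

End skorokhod.

(** * Tightness *)

(* Tightness of the sequence of the distributions of X_1, X_2, ... *)
Definition tight (R : realType) d (Omega : measurableType d)
    (P : probability Omega R) (T : topologicalType) (X : nat -> Omega -> T) :
    Prop :=
  forall e : R, 0 < e -> exists2 K : set T, compact K &
    forall n, (0 < n)%N -> ((1 - e)%:E <= P (X n @^-1` K))%E.

(* Main.v *)
Require Import Defs.
From mathcomp Require Import all_boot all_order all_algebra.
From mathcomp Require Import all_classical all_reals all_analysis.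
From mathcomp Require Import zify lra measurable_realfun.

(** The function m o h has jumps in every interval unless the rows of p are
geometric. Indeed, h jumps from u i top top... to u (i+1) 000..., where top is
the largest letter, at the common end point of the cylinder intervals of u i and
u (i+1), and m takes equal values on all these pairs of strings only if p has
geometric rows ([geometric_rows_of_balance], [mh_jump]).

At a jump t0 of m o h the centering m(h(t)) n changes by a multiple of n. A path
that is bounded independently of n can only follow if the numbers of bucket
operations for the ranks l and l + 1, where l = floor(t0 n), differ by a multiple
of n as well ([neighbour_ranks_apart]). Now the contribution to Z_n of prefixes
of length at least K is at most a small multiple of n, uniformly over all
strings, except with a probability that tends to 0 ([prob_deep_crowd_cvg0]); this
follows from a union bound over the sets of strings with a common prefix. So the
order statistics of ranks l and l + 1 differ in their first K letters
([Zn_close]), and l is the number of strings whose first K letters do not exceed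
a certain word of length K ([count_order_stat]). In other words, the number of
strings below one of finitely many fixed boundaries equals floor(t0 n).

This cannot hold with large probability for all large n. With a positive
probability independent of n, all the strings after the n-th one up to the
(n + N k)-th one begin with K copies of the largest letter. They then do not change the
numbers of strings below the boundaries, whereas floor(t0 n) takes different
values at n, n + k, ..., n + N k; for N at least the number of words of length K
there are more such values than boundaries ([prefix_pigeonhole]).

Relatively compact sets of the Skorokhod space are bounded in the supremum norm
([compact_skorokhod_bounded]), so this contradicts tightness. As [tight] refers
to the values of P on preimages of compact sets, these have to be events, which
holds since there are only countably many possible paths ([measurable_calY]);
and the paths have to be cadlag to be represented in the space at all
([calY_cadlag]). *)

Set Implicit Arguments.
Unset Strict Implicit.
Unset Printing Implicit Defensive.
Import Order.TTheory GRing.Theory Num.Theory.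
Import numFieldNormedType.Exports.
Local Open Scope classical_set_scope.
Local Open Scope ring_scope.

(** * Strings, prefix probabilities and the function m *)

Section strings.
Variable b : nat.
Implicit Types u v w : istring b.

Lemma lcp_geE k v w : lcp_ge k v w = (mkseq v k == mkseq w k).
Proof.
rewrite /lcp_ge; case: lcpP => [->|i vwi nvw]; first by rewrite eqxx.
apply/idP/eqP => [ki|/mkseq_eqP vwk].
  by apply/mkseq_eqP => j jk; apply: vwi; exact: leq_trans jk ki.
by rewrite leqNgt; apply/negP => /vwk /eqP; exact/negP.
Qed.

Lemma mkseq_eqW i k v w :
  (i <= k)%N -> mkseq v k = mkseq w k -> mkseq v i = mkseq w i.
Proof.
move=> ik /mkseq_eqP vw; apply/mkseq_eqP => j ji.
exact: vw (leq_trans ji ik).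
Qed.

Definition upd v k r : istring b := fun j => if j == k then r else v j.

Lemma upd_eq v k r : upd v k r k = r.
Proof. by rewrite /upd eqxx. Qed.

Lemma mkseq_upd v k r : mkseq (upd v k r) k = mkseq v k.
Proof. by apply/mkseq_eqP => j jk; rewrite /upd ltn_eqF. Qed.

Lemma mkseqS_eqP v w k :
  mkseq v k.+1 = mkseq w k.+1 <-> mkseq v k = mkseq w k /\ v k = w k.
Proof.
split=> [vw|[/mkseq_eqP vw vwk]].
  by split; [exact: mkseq_eqW vw|move/mkseq_eqP : vw; apply].
by apply/mkseq_eqP => j; rewrite ltnS leq_eqVlt => /predU1P[->//|/vw].
Qed.

(** The form of dependent choice that yields the strings on the two sides of a
    point of the unit interval, one letter at a time. *)
Lemma greedy_string (Q : istring b -> nat -> Prop) v0 :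
  (forall v w k, mkseq v k = mkseq w k -> Q v k -> Q w k) ->
  Q v0 0%N -> (forall v k, Q v k -> exists r, Q (upd v k r) k.+1) ->
  exists w, forall k, Q w k.
Proof.
move=> Qprefix Q0 Qstep.
have ex vk : exists r, Q vk.1 vk.2 -> Q (upd vk.1 vk.2 r) vk.2.+1.
  have [/Qstep[r Qr]|nQ] := pselect (Q vk.1 vk.2); first by exists r.
  by exists (v0 0%N).
have [f fQ] := choice ex.
pose st := fix st k := if k is i.+1 then upd (st i) i (f (st i, i)) else v0.
have Qst k : Q (st k) k by elim: k => //= k /(fQ (st k, k)).
pose w : istring b := fun k => st k.+1 k.
have wst k : mkseq (st k) k = mkseq w k.
  elim: k => [|k IH]; first exact/mkseq_eqP.
  by apply/mkseqS_eqP; split=> //; rewrite -IH /= mkseq_upd.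
by exists w => k; exact: Qprefix (Qst k).
Qed.

Lemma lexlt_ltP v w : reflect
  (exists2 i, mkseq v i = mkseq w i & (v i < w i)%N) (v < w)%O.
Proof.
rewrite istring_ltE; apply: (iffP (lexltP v w)) => -[i vwi vi]; exists i => //.
  exact/mkseq_eqP.
exact/mkseq_eqP.
Qed.

Lemma mkseq_dec v w k : mkseq v k = mkseq w k \/
  (exists i, [/\ (i < k)%N, mkseq v i = mkseq w i & v i <> w i]).
Proof.
elim: k => [|k [vw|[i [ik vw nvw]]]]; first by left.
  have [vwk|/eqP nvwk] := eqVneq (v k) (w k).
    by left; apply/mkseqS_eqP.
  by right; exists k.
by right; exists i; rewrite (ltn_trans ik).
Qed.

End strings.

Section weights.
Context (R : realType) (b : nat).
Variables (mu : 'I_b -> R) (p : 'I_b -> 'I_b -> R).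
Implicit Types u v w : istring b.

(** The initial distribution is treated as the transition into position 0, so
    that [weight] below, the function pi of prefixes, is one product. *)
Definition step v j q : R := if j is i.+1 then p (v i) q else mu q.

Definition weight v k : R := \prod_(j < k) step v j (v j).

Lemma step_prefix v w j : mkseq v j = mkseq w j -> step v j = step w j.
Proof. by case: j => //= j /mkseq_eqP/(_ j (ltnSn j)) vwj; rewrite /step vwj. Qed.

Lemma weight_prefix v w k : mkseq v k = mkseq w k -> weight v k = weight w k.
Proof.
move=> vw; apply: eq_bigr => -[j jk] _ /=.
rewrite (step_prefix (mkseq_eqW (ltnW jk) vw)).
by move/mkseq_eqP/(_ j jk) : vw => ->.
Qed.

Lemma weightS v k : weight v k.+1 = weight v k * step v k (v k).
Proof. by rewrite /weight big_ord_recr. Qed.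

Lemma weight0 v : weight v 0 = 1.
Proof. by rewrite /weight big_ord0. Qed.

Lemma weight_upd v k r : weight (upd v k r) k.+1 = weight v k * step v k r.
Proof.
rewrite weightS upd_eq (weight_prefix (mkseq_upd v k r)).
by rewrite (step_prefix (mkseq_upd v k r)).
Qed.

Lemma word_prob_mkseq v k : word_prob mu p (mkseq v k) = weight v k.
Proof.
case: k => [|k]; first by rewrite weight0.
elim: k => [|k IH].
  by rewrite /weight big_ord_recl big_ord0 /= big_nil.
rewrite weightS -IH mkseqS [step _ _ _]/=.
case E : (mkseq v k.+1) => [|x s]; first by move/(congr1 size): E; rewrite size_mkseq.
have <- : last x (x :: s) = v k by rewrite -E mkseqS last_rcons.
by rewrite rcons_cons /= -cats1 pairmap_cat big_cat /= big_seq1 mulrA.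
Qed.

Hypothesis src : source_params mu p.

Lemma step_gt0 v j q : 0 < step v j q.
Proof.
have [mu01 _ p01 _] := src; case: j => [|j] /=.
  by have /andP[] := mu01 q.
by have /andP[] := p01 (v j) q.
Qed.

Lemma sum_step v j : \sum_q step v j q = 1.
Proof. by have [_ mu1 _ p1] := src; case: j => [|j] /=. Qed.

Lemma weight_gt0 v k : 0 < weight v k.
Proof. by apply: prodr_gt0 => j _; exact: step_gt0. Qed.

Lemma m_funE v : m_fun mu p v = limn (series (weight v)).
Proof.
rewrite /m_fun; congr (limn (series _)).
by apply/funext => k; exact: word_prob_mkseq.
Qed.

Lemma series_shiftE (u : R ^nat) k n :
  series u (n + k)%N = series u k + series (fun j => u (k + j)%N) n.
Proof.
rewrite !seriesEnat /= (big_cat_nat _ (leq_addl n k)) //=; congr (_ + _).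
by rewrite -{1}[k]add0n big_addn addnK; apply: eq_bigr => j _; rewrite addnC.
Qed.

(** From the second letter of the constant part on, the prefix weights form a
    geometric sequence. *)
Lemma m_fun_eventually_const v k z : (forall j, (k < j)%N -> v j = z) ->
  m_fun mu p v = series (weight v) k.+1 +
    weight v k.+1 * (1 + p (v k) z / (1 - p z z)).
Proof.
move=> vz; have [_ _ p01 _] := src; rewrite m_funE.
have /andP[pz0 pz1] := p01 z z.
set g := geometric (weight v k.+1 * p (v k) z) (p z z).
have wS n : weight v (k.+2 + n) = g n.
  elim: n => [|n IH].
    by rewrite addn0 weightS /step (vz k.+1)// /g /= expr0 mulr1.
  rewrite addnS weightS IH /g /= exprSr mulrA; congr (_ * _).
  by rewrite addSn /step !vz //; lia.
have sE : (fun n => series (weight v) (n + k.+2)%N) =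
    (fun n => series (weight v) k.+2 + series g n).
  apply/funext => n; rewrite series_shiftE; congr (_ + series _ _).
  by apply/funext => j; exact: wS.
have cg : series g @ \oo --> weight v k.+1 * p (v k) z / (1 - p z z).
  by apply: cvg_geometric_series; rewrite ger0_norm// ltW.
apply: cvg_lim; first exact: Rhausdorff.
rewrite -(cvg_shiftn k.+2) /= sE.
have -> : series (weight v) k.+1 + weight v k.+1 * (1 + p (v k) z / (1 - p z z)) =
    series (weight v) k.+2 + weight v k.+1 * p (v k) z / (1 - p z z).
  by rewrite [in RHS]seriesSr mulrDr mulr1 !addrA mulrA.
by apply: cvgD cg; exact: cvg_cst.
Qed.

Lemma step_bound : exists2 rho, 0 < rho < 1 & forall v j q, step v j q <= rho.
Proof.
have [mu01 mu1 p01 p1] := src.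
pose rho : R := Num.max 2^-1
  (Num.max (\big[Num.max/0]_i mu i) (\big[Num.max/0]_i \big[Num.max/0]_j p i j)).
exists rho.
  rewrite /rho lt_max invr_gt0 ltr0n /= !gt_max invf_lt1 ?ltr0n// ltr1n /=.
  apply/andP; split.
    by apply/bigmax_ltP; split=> // i _; have /andP[] := mu01 i.
  apply/bigmax_ltP; split=> // i _; apply/bigmax_ltP; split=> // j _.
  by have /andP[] := p01 i j.
move=> v [|j] q /=; rewrite /rho !le_max; apply/orP; right; apply/orP.
  by left; exact: le_bigmax.
by right; apply: bigmax_sup (le_bigmax _ _ q).
Qed.

Variable rho : R.
Hypotheses (rho01 : 0 < rho < 1) (step_le : forall v j q, step v j q <= rho).

Let rho_gt0 : 0 < rho. Proof. by case/andP: rho01. Qed.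
Let rho_lt1 : rho < 1. Proof. by case/andP: rho01. Qed.

Lemma weight_le v k : weight v k <= rho ^+ k.
Proof.
rewrite -[k in rho ^+ k]card_ord -prodr_const.
by apply: ler_prod => j _; rewrite (ltW (step_gt0 _ _ _)) step_le.
Qed.

Lemma weight_add v k n : weight v (k + n) <= weight v k * rho ^+ n.
Proof.
elim: n => [|n IH]; first by rewrite addn0 expr0 mulr1.
rewrite addnS weightS exprSr mulrA ler_pM//.
- exact/ltW/weight_gt0.
- exact/ltW/step_gt0.
Qed.

Lemma cvg_weight v : cvgn (series (weight v)).
Proof.
apply: (@series_le_cvg _ _ (geometric 1 rho)).
- by move=> n; exact/ltW/weight_gt0.
- by move=> n /=; rewrite mul1r exprn_ge0// ltW.
- by move=> n /=; rewrite mul1r weight_le.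
- by apply: is_cvg_geometric_series; rewrite ger0_norm// ltW.
Qed.

(** The weights after position [k] are dominated by a geometric sequence; in
    particular m is continuous for the product topology. *)
Lemma m_fun_tail v k : series (weight v) k <= m_fun mu p v <=
  series (weight v) k + rho ^+ k / (1 - rho).
Proof.
have cw : cvgn (series (weight v)) by exact: cvg_weight.
rewrite m_funE; apply/andP; split.
  apply: nondecreasing_cvgn_le => //; apply/nondecreasing_seqP => n.
  by rewrite seriesSr lerDl ltW// weight_gt0.
apply: limr_le => //; near=> n.
have kn : (k <= n)%N by near: n; exact: nbhs_infty_ge.
rewrite -(subnK kn) series_shiftE lerD2l.
have cg : series (geometric (rho ^+ k) rho) @ \oo --> rho ^+ k / (1 - rho).
  by apply: cvg_geometric_series; rewrite ger0_norm// ltW.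
rewrite -(cvg_lim (@Rhausdorff R) cg).
apply: (@le_trans _ _ (series (geometric (rho ^+ k) rho) (n - k)%N)).
  apply: ler_sum => j _ /=; apply: le_trans (weight_add _ _ _) _.
  by rewrite ler_wpM2r ?weight_le// exprn_ge0// ltW.
apply: nondecreasing_cvgn_le; last exact: cvgP cg.
apply/nondecreasing_seqP => j.
by rewrite seriesSr lerDl /= mulr_ge0// exprn_ge0// ltW.
Unshelve. all: by end_near. Qed.

Lemma m_fun_prefix v w k : mkseq v k = mkseq w k ->
  `|m_fun mu p v - m_fun mu p w| <= rho ^+ k / (1 - rho).
Proof.
move=> vw; have /andP[v1 v2] := m_fun_tail v k; have /andP[w1 w2] := m_fun_tail w k.
have e : series (weight v) k = series (weight w) k.
  rewrite !seriesEord; apply: eq_bigr => -[j jk] _ /=.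
  exact: weight_prefix (mkseq_eqW (ltnW jk) vw).
rewrite e in v1 v2; rewrite ler_norml; apply/andP; split; lra.
Qed.

End weights.

(** * Cylinder intervals and the string h(t) *)

Section intervals.
Context (R : realType) (b : nat).
Variables (mu : 'I_b -> R) (p : 'I_b -> 'I_b -> R).
Implicit Types u v w : istring b.
Notation step := (step mu p).
Notation weight := (weight mu p).

(** The strings sharing the first [k] letters of [v] occupy the interval from
    [lend v k] to [rend v k] in the range of the distribution function. *)
Definition lend v k : R :=
  \sum_(j < k) weight v j * \sum_(q < b | (q < v j)%N) step v j q.

Definition rend v k : R := lend v k + weight v k.

Lemma lend0 v : lend v 0 = 0.
Proof. by rewrite /lend big_ord0. Qed.

Lemma lendS v k : lend v k.+1 =
  lend v k + weight v k * \sum_(q < b | (q < v k)%N) step v k q.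
Proof. by rewrite /lend big_ord_recr. Qed.

Lemma sum_stepS v k (i : 'I_b) :
  \sum_(q < b | (q < i.+1)%N) step v k q =
  \sum_(q < b | (q < i)%N) step v k q + step v k i.
Proof.
rewrite (bigD1 i) //= addrC; congr (_ + _); apply: eq_bigl => q.
by rewrite ltnS [RHS]ltn_neqAle andbC.
Qed.

Lemma rendS v k : rend v k.+1 =
  lend v k + weight v k * \sum_(q < b | (q < (v k).+1)%N) step v k q.
Proof. by rewrite /rend lendS weightS sum_stepS mulrDr addrA. Qed.

Lemma lend_prefix v w k : mkseq v k = mkseq w k -> lend v k = lend w k.
Proof.
move=> vw; apply: eq_bigr => -[j jk] _ /=; have vwj := mkseq_eqW (ltnW jk) vw.
rewrite (weight_prefix _ _ vwj) (step_prefix _ _ vwj).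
by move/mkseq_eqP/(_ j jk) : vw => ->.
Qed.

Lemma rend_prefix v w k : mkseq v k = mkseq w k -> rend v k = rend w k.
Proof. by move=> vw; rewrite /rend (lend_prefix vw) (weight_prefix _ _ vw). Qed.

Hypothesis src : source_params mu p.

Lemma sum_step_le v k (i j : nat) : (i <= j)%N ->
  \sum_(q < b | (q < i)%N) step v k q <= \sum_(q < b | (q < j)%N) step v k q.
Proof.
move=> ij; rewrite [leRHS](bigID (fun q : 'I_b => q < i)%N) /=.
have -> : \sum_(q < b | (q < i)%N) step v k q =
    \sum_(q < b | (q < j)%N && (q < i)%N) step v k q.
  by apply: eq_bigl => q; case: (ltnP q i) => [qi|]; rewrite ?andbF// (leq_trans qi).
by rewrite lerDl sumr_ge0// => q _; exact/ltW/(step_gt0 src).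
Qed.

Lemma sum_step_top v k : \sum_(q < b | (q < b)%N) step v k q = 1.
Proof. by rewrite (eq_bigl predT) ?(sum_step src)// => q; rewrite ltn_ord. Qed.

Lemma lend_lt_rend v k : lend v k < rend v k.
Proof. by rewrite /rend ltrDl (weight_gt0 src). Qed.

Lemma lend_le v i k : (i <= k)%N -> lend v i <= lend v k.
Proof.
move=> /subnK <-; elim: (k - i)%N => // n IH.
rewrite addSn; apply: le_trans IH _; rewrite lendS lerDl mulr_ge0//.
  exact/ltW/(weight_gt0 src).
by rewrite sumr_ge0// => q _; exact/ltW/(step_gt0 src).
Qed.

Lemma rend_le v i k : (i <= k)%N -> rend v k <= rend v i.
Proof.
move=> /subnK <-; elim: (k - i)%N => // n IH.
rewrite addSn; apply: le_trans IH; rewrite rendS /rend lerD2l.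
rewrite -[leRHS]mulr1 ler_wpM2l ?(ltW (weight_gt0 src _ _))//.
by rewrite -(sum_step_top v (n + i)) sum_step_le.
Qed.

Lemma lend_ge0 v k : 0 <= lend v k.
Proof. by rewrite -(lend0 v) lend_le. Qed.

Lemma rend_le1 v k : rend v k <= 1.
Proof.
apply: le_trans (rend_le v (leq0n k)) _.
by rewrite /rend lend0 weight0 add0r.
Qed.

Lemma rend_le_lend v w i : mkseq v i = mkseq w i -> (v i < w i)%N ->
  rend v i.+1 <= lend w i.+1.
Proof.
move=> vw vwi; rewrite rendS lendS (lend_prefix vw) (weight_prefix _ _ vw).
rewrite (step_prefix _ _ vw) lerD2l ler_wpM2l ?sum_step_le//.
exact/ltW/(weight_gt0 src).
Qed.

(** The subintervals of a cylinder interval given by the next letter cover it,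
    so that nested cylinder intervals can follow any cut [Q] of the unit
    interval. The points at most [t] lead to h(t), the points below [t] to the
    limit of h from the left at [t]. *)
Lemma cut_string (Q : pred R) : Q 0 -> ~~ Q 1 ->
  exists w, forall k, Q (lend w k) && ~~ Q (rend w k).
Proof.
move=> Q0 Q1.
have [b0|b_gt0] := posnP b.
  have [_ mu1 _ _] := src; have : 0 = 1 :> R.
    rewrite -mu1 big1// => -[i ib]; exfalso; move: ib; by rewrite b0.
  by move=> e; move: Q1; rewrite -e Q0.
apply: (@greedy_string _ _ (fun=> Ordinal b_gt0)).
- by move=> v w k vw; rewrite (lend_prefix vw) (rend_prefix vw).
- by rewrite /rend lend0 weight0 add0r Q0.
move=> v k /andP[Ql Qr].
pose a i := lend v k + weight v k * \sum_(q < b | (q < i)%N) step v k q.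
have a0 : Q (a 0%N) by rewrite /a big1 ?mulr0 ?addr0.
have ab : ~~ Q (a b) by rewrite /a sum_step_top mulr1.
have [i ib /andP[Qi nQi]] : exists2 i, (i < b)%N & Q (a i) && ~~ Q (a i.+1).
  apply: contrapT => nex; suff aQ i : (i <= b)%N -> Q (a i).
    by move: ab; rewrite aQ.
  elim: i => // i IH ib; apply: contrapT => /negP nQ.
  by apply: nex; exists i => //; rewrite IH// ltnW.
exists (Ordinal ib); rewrite lendS rendS upd_eq.
rewrite (lend_prefix (mkseq_upd v k _)) (weight_prefix _ _ (mkseq_upd v k _)).
by rewrite (step_prefix _ _ (mkseq_upd v k _)) Qi.
Qed.

Variable rho : R.
Hypotheses (rho01 : 0 < rho < 1) (step_le : forall v j q, step v j q <= rho).

Lemma rend_lend v k : rend v k <= lend v k + rho ^+ k.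
Proof. by rewrite lerD2l (weight_le src). Qed.

Lemma rho_small (e : R) : 0 < e -> exists k, rho ^+ k < e.
Proof.
move=> e0; have /cvgrPdist_lt : geometric 1 rho @ \oo --> 0.
  apply: cvg_geometric; case/andP: rho01 => r0 r1.
  by rewrite ger0_norm// ltW.
move=> /(_ e e0)[k _ /(_ k (leqnn k))] /=.
rewrite sub0r normrN mul1r => re; exists k.
exact: le_lt_trans (ler_norm _) re.
Qed.

Variables (b_gt1 : (1 < b)%N) (F : istring b -> R).
Hypothesis F_bounds : forall w k, lend w k <= F w <= rend w k.
Notation h := (h_fun b_gt1 F).

(** [F w = t] since the intervals around [t] shrink to a point, while a larger
    string leaves them on the right at its first different letter. *)
Lemma h_funE t w : (forall k, lend w k <= t < rend w k) -> h t = w.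
Proof.
move=> wt; set A : set (istring b) := [set v | F v <= t].
have Aw : A w.
  rewrite /A /=; apply/ler_addgt0Pr => e /rho_small[k ke].
  have /andP[_ Fr] := F_bounds w k; apply: le_trans Fr _.
  have /andP[lt _] := wt k; apply: le_trans (rend_lend _ _) _.
  by rewrite lerD// ltW.
have ubA : ubound A w.
  move=> v Av; rewrite leNgt; apply/negP => /lexlt_ltP[i wv wvi].
  have /andP[_] := wt i.+1; rewrite ltNge => /negP; apply.
  apply: le_trans (rend_le_lend wv wvi) _.
  by have /andP[lF _] := F_bounds v i.+1; apply: le_trans lF _.
have supw : supremums A w by split=> // v; exact.
rewrite /h_fun /supremum -/A ifF; last first.
  by apply/negbTE/set0P; exists w.
by apply: xget_unique => // v sv; exact: is_subset1_supremums sv supw.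
Qed.

(** Hence h is constant up to the first [k] letters on the half-open cylinder
    intervals of depth [k]; these are closed on the left, which is why m o h is
    continuous from the right. *)
Lemma h_fun_prefix t v k : lend v k <= t < rend v k ->
  mkseq (h t) k = mkseq v k.
Proof.
move=> /andP[vt tv].
have t0 : 0 <= t by exact: le_trans (lend_ge0 _ _) vt.
have t1 : ~~ (1 <= t) by rewrite -ltNge; exact: lt_le_trans tv (rend_le1 _ _).
have [w wQ] := @cut_string (fun x => x <= t) t0 t1.
have wt j : lend w j <= t < rend w j by have := wQ j; rewrite -ltNge.
rewrite (h_funE wt).
have [//|[i [ik wvi /eqP]]] := mkseq_dec w v k.
rewrite -val_eqE neq_ltn => /orP[lt|lt].
  have /andP[_] := wt i.+1; rewrite ltNge => /negP[].
  by apply: le_trans (rend_le_lend wvi lt) _; exact: le_trans (lend_le _ ik) vt.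
have : t < t.
  apply: lt_le_trans tv _; apply: le_trans (rend_le _ ik) _.
  apply: le_trans (rend_le_lend (esym wvi) lt) _.
  by have /andP[] := wt i.+1.
by rewrite ltxx.
Qed.

Lemma m_fun_small (e : R) : 0 < e -> exists k, forall v w,
  mkseq v k = mkseq w k -> `|m_fun mu p v - m_fun mu p w| < e.
Proof.
move=> e0; have rho1 : 0 < 1 - rho by rewrite subr_gt0; case/andP: rho01.
have [k ke] := rho_small (mulr_gt0 e0 rho1).
exists k => v w vw; apply: le_lt_trans (m_fun_prefix src rho01 step_le vw) _.
by rewrite ltr_pdivrMr.
Qed.

Notation mh := (fun t => m_fun mu p (h t)).

Lemma mh_right t w : (forall k, lend w k <= t < rend w k) ->
  mh x @[x --> t^'+] --> m_fun mu p w.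
Proof.
move=> wt; apply/cvgrPdist_lt => e /m_fun_small[k ke].
have /andP[lt tr] := wt k; near=> x; apply: ke; apply/esym/h_fun_prefix.
apply/andP; split; last by near: x; exact: nbhs_right_lt.
by apply: le_trans lt _; near: x; exact: nbhs_right_ge.
Unshelve. all: by end_near. Qed.

Lemma mh_left t w : (forall k, lend w k < t <= rend w k) ->
  mh x @[x --> t^'-] --> m_fun mu p w.
Proof.
move=> wt; apply/cvgrPdist_lt => e /m_fun_small[k ke].
have /andP[lt tr] := wt k; near=> x; apply: ke; apply/esym/h_fun_prefix.
apply/andP; split; first by near: x; exact: nbhs_left_ge.
by apply: lt_le_trans tr; near: x; exact: nbhs_left_lt.
Unshelve. all: by end_near. Qed.

Lemma mh_cadlag c d : 0 <= c -> d <= 1 -> cadlag c d mh.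
Proof.
move=> c0 d1; split=> t /andP[ct td].
  have t0 : 0 <= t by exact: le_trans ct.
  have t1 : ~~ (1 <= t) by rewrite -ltNge; exact: lt_le_trans td d1.
  have [w wQ] := @cut_string (fun x => x <= t) t0 t1.
  have wt j : lend w j <= t < rend w j by have := wQ j; rewrite -ltNge.
  by rewrite [in X in _ --> X](h_funE wt); exact: mh_right.
have t0 : 0 < t by exact: le_lt_trans ct.
have t1 : ~~ (1 < t) by rewrite -leNgt (le_trans td).
have [w wQ] := @cut_string (fun x => x < t) t0 t1.
have wt j : lend w j < t <= rend w j by have := wQ j; rewrite -leNgt.
by apply/cvg_ex; exists (m_fun mu p w); exact: mh_left.
Qed.

End intervals.

(** * Jumps of m o h *)

Section jumps.
Context (R : realType) (b : nat).
Variables (mu : 'I_b.+2 -> R) (p : 'I_b.+2 -> 'I_b.+2 -> R).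
Implicit Types u v w : istring b.+2.
Notation step := (step mu p).
Notation weight := (weight mu p).
Notation lend := (lend mu p).
Notation rend := (rend mu p).
Hypothesis src : source_params mu p.

(** Once the letter r is reached with prefix probability q, the prefixes ending
    at or after it contribute q * alpha r to m if only 0 follows, and
    q * gamma r if only the largest letter, here called top, follows. *)
Let alpha r := 1 + p r ord0 / (1 - p ord0 ord0).
Let gamma r := 1 + p r ord_max / (1 - p ord_max ord_max).

(** The equation says that m takes the same value on the strings u i top top...
    and u (i+1) 000..., which are neighbours in the lexicographic order, where x
    is the last letter of u. The ratio of the entries i and i+1 of a row of p
    then does not depend on the row, so that all rows are equal; thereby alpha
    and gamma become constant, and the ratio does not depend on i either. *)
Lemma geometric_rows_of_balance :
  (forall x i j : 'I_b.+2, j = i.+1 :> nat ->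
    p x i * gamma i = p x j * alpha j) ->
  exists2 beta : R, 0 < beta & geometric_rows p beta.
Proof.
move=> bal; have [_ _ p01 p1] := src.
have p_gt0 x y : 0 < p x y by have /andP[] := p01 x y.
have p_lt1 x y : 0 < 1 - p x y by rewrite subr_gt0; have /andP[] := p01 x y.
have alpha_gt0 r : 0 < alpha r by rewrite /alpha addr_gt0// divr_gt0.
have gamma_gt0 r : 0 < gamma r by rewrite /gamma addr_gt0// divr_gt0.
have prop x y (i : nat) (ib : (i < b.+2)%N) :
    p x (Ordinal ib) * p y ord0 = p y (Ordinal ib) * p x ord0.
  elim: i ib => [|i IH] ib.
    by rewrite (_ : Ordinal ib = ord0) 1?mulrC//; exact: val_inj.
  have balx z := bal z (Ordinal (ltnW ib)) (Ordinal ib) erefl.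
  apply: (mulIf (lt0r_neq0 (alpha_gt0 (Ordinal ib)))).
  by rewrite mulrAC -balx [RHS]mulrAC -balx mulrAC IH mulrAC.
have row0 x y : p x ord0 = p y ord0.
  rewrite -[LHS]mul1r -[RHS]mul1r -{1}(p1 y) -(p1 x) !mulr_suml.
  by apply: eq_bigr => -[i ib] _; rewrite prop.
have row x y i : p x i = p y i.
  case: i => i ib; apply: (mulIf (lt0r_neq0 (p_gt0 y ord0))).
  by rewrite prop (row0 x y).
pose q i := p ord0 i.
have pq x i : p x i = q i by exact: row.
pose beta := (1 - q ord0) / (1 - q ord_max).
have beta_gt0 : 0 < beta by apply: divr_gt0; exact: p_lt1.
exists beta => //.
have alphaE r : alpha r = (1 - q ord0)^-1.
  rewrite /alpha !pq; have := p_lt1 ord0 ord0; rewrite -/(q ord0) => h.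
  by apply: (mulIf (lt0r_neq0 h)); rewrite mulVf ?mulrDl ?divfK ?lt0r_neq0//; lra.
have gammaE r : gamma r = (1 - q ord_max)^-1.
  rewrite /gamma !pq; have := p_lt1 ord0 ord_max; rewrite -/(q ord_max) => h.
  by apply: (mulIf (lt0r_neq0 h)); rewrite mulVf ?mulrDl ?divfK ?lt0r_neq0//; lra.
have qE (i : nat) (ib : (i < b.+2)%N) : q (Ordinal ib) = q ord0 * beta ^+ i.
  elim: i ib => [|i IH] ib.
    by rewrite expr0 mulr1; congr q; exact: val_inj.
  have e := bal ord0 (Ordinal (ltnW ib)) (Ordinal ib) erefl.
  rewrite alphaE gammaE !pq IH in e.
  rewrite exprSr mulrA -[X in _ * X]/((1 - q ord0) / (1 - q ord_max)).
  by rewrite mulrA mulrAC e divfK// lt0r_neq0// /q.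
have qsum : q ord0 * \sum_(i < b.+2) beta ^+ i = 1.
  by rewrite mulr_sumr -(p1 ord0); apply: eq_bigr => -[i ib] _; rewrite pq qE.
move=> x [r rb]; rewrite pq qE; case: ifPn => [/eqP b1|b1].
  have bn0 : b.+2%:R != 0 :> R by rewrite pnatr_eq0.
  have sumE : \sum_(i < b.+2) beta ^+ i = b.+2%:R.
    by rewrite b1 (eq_bigr (fun=> 1)) ?sumr_const ?card_ord// => i _; rewrite expr1n.
  rewrite sumE in qsum.
  by rewrite b1 expr1n mulr1; apply: (mulIf bn0); rewrite mulVf.
congr (_ * _); have b1' : 1 - beta != 0 by rewrite subr_eq0 eq_sym.
have geo : 1 - beta ^+ b.+2 = (1 - beta) * \sum_(i < b.+2) beta ^+ i.
  by rewrite -[LHS]opprB subrX1 -mulNr opprB.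
have S0 : \sum_(i < b.+2) beta ^+ i != 0.
  by apply/eqP => S0; move/eqP: qsum; rewrite S0 mulr0 eq_sym oner_eq0.
by rewrite geo invfM mulrA mulfV// mul1r; apply: (mulIf S0); rewrite qsum mulVf.
Qed.

(** The string u i z z z... where u consists of [k] letters of [w] and of [x]. *)
Let bend w k (x i z : 'I_b.+2) : istring b.+2 := fun j =>
  if (j < k)%N then w j else if j == k then x else if j == k.+1 then i else z.

Let bend_prefix w k x i z : mkseq (bend w k x i z) k = mkseq w k.
Proof. by apply/mkseq_eqP => j jk; rewrite /bend jk. Qed.

Let bend_i w k x i z : bend w k x i z k.+1 = i.
Proof. by rewrite /bend ltnNge leqnSn /= eqn_leq ltnn eqxx. Qed.

Let bend_tail w k x i z j : (k.+1 < j)%N -> bend w k x i z j = z.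
Proof.
move=> kj; rewrite /bend ltnNge (ltnW (ltnW kj)) /=.
by rewrite gtn_eqF ?(ltnW kj)// gtn_eqF.
Qed.

Let bend_common w k x i z i' z' :
  mkseq (bend w k x i z) k.+1 = mkseq (bend w k x i' z') k.+1.
Proof.
apply/mkseq_eqP => j; rewrite ltnS /bend; case: ltnP => // kj jk.
by rewrite eqn_leq jk kj.
Qed.

Lemma lend_zeros v k j : (forall n, (k <= n)%N -> v n = ord0) -> (k <= j)%N ->
  lend v j = lend v k.
Proof.
move=> v0 /subnK <-; elim: (j - k)%N => // n IH.
rewrite addSn lendS IH v0 ?leq_addl// [X in _ * X]big1 ?mulr0 ?addr0//.
Qed.

Lemma rend_tops v k j : (forall n, (k <= n)%N -> v n = ord_max) -> (k <= j)%N ->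
  rend v j = rend v k.
Proof.
move=> v0 /subnK <-; elim: (j - k)%N => // n IH.
by rewrite addSn rendS v0 ?leq_addl// (sum_step_top src) mulr1.
Qed.

Variable rho : R.
Hypotheses (rho01 : 0 < rho < 1) (step_le : forall v j q, step v j q <= rho).
Variables (b_gt1 : (1 < b.+2)%N) (F : istring b.+2 -> R).
Hypothesis F_bounds : forall w k, lend w k <= F w <= rend w k.
Notation h := (h_fun b_gt1 F).
Notation mh := (fun t => m_fun mu p (h t)).

(** Every interval contains a cylinder interval. For each x and i it contains
    the cylinder intervals of u i and u (i+1) for some u with last letter x; at
    their common end point, h jumps from u i top top... to u (i+1) 000... *)
Lemma mh_jump (c d : R) : 0 <= c -> c < d -> d <= 1 ->
  ~ (exists2 beta : R, 0 < beta & geometric_rows p beta) ->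
  exists2 t, c < t < d & exists2 l, mh x @[x --> t^'-] --> l & mh t != l.
Proof.
move=> c0 cd d1 ngeo; have [_ _ p01 _] := src.
have [x [i [j [ji /eqP nbal]]]] : exists x i j : 'I_b.+2,
    j = i.+1 :> nat /\ p x i * gamma i <> p x j * alpha j.
  apply: contrapT => nex; apply/ngeo/geometric_rows_of_balance => x i j ji.
  by apply: contrapT => ne; apply: nex; exists x, i, j.
pose mid := (c + d) / 2.
have mid0 : 0 <= mid by rewrite /mid; lra.
have mid1 : ~~ (1 <= mid) by rewrite -ltNge /mid; lra.
have [w wQ] := @cut_string _ _ _ _ src (fun x => x <= mid) mid0 mid1.
have wmid k : lend w k <= mid < rend w k by have := wQ k; rewrite -ltNge.
have dc : 0 < (d - c) / 2 by lra.
have [k rk] := rho_small rho01 dc.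
have rlw := rend_lend src step_le w k; have /andP[lm mr] := wmid k.
have cl : c < lend w k by rewrite /mid in lm mr *; lra.
have rd : rend w k < d by rewrite /mid in lm mr *; lra.
pose vl := bend w k x i ord_max; pose vr := bend w k x j ord0.
have vli : vl k.+1 = i by exact: bend_i.
have vrj : vr k.+1 = j by exact: bend_i.
have common : mkseq vl k.+1 = mkseq vr k.+1 by exact: bend_common.
pose t := lend vr k.+2.
have tE : t = rend vl k.+2.
  rewrite /t lendS rendS (lend_prefix _ _ common) (weight_prefix _ _ common).
  by rewrite (step_prefix _ _ common) vli vrj ji.
have vrt n : lend vr n <= t < rend vr n.
  have [nk|kn] := leqP n k.+2.
    rewrite (lend_le src) //= (lt_le_trans _ (rend_le src _ nk))//.
    exact: lend_lt_rend.
  have e : lend vr n = t.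
    by apply: lend_zeros (ltnW kn) => a ka; exact: bend_tail.
  by rewrite -e lexx lend_lt_rend.
have vlt n : lend vl n < t <= rend vl n.
  rewrite tE; have [nk|kn] := leqP n k.+2.
    rewrite (rend_le src _ nk) andbT (le_lt_trans (lend_le src _ nk))//.
    exact: lend_lt_rend.
  have e : rend vl n = rend vl k.+2.
    by apply: rend_tops (ltnW kn) => a ka; exact: bend_tail.
  by rewrite -e lexx andbT lend_lt_rend.
exists t.
  have wl : mkseq w k = mkseq vl k by rewrite bend_prefix.
  have wr : mkseq w k = mkseq vr k by rewrite bend_prefix.
  apply/andP; split.
    apply: lt_trans cl _; rewrite (lend_prefix _ _ wl).
    by have /andP[] := vlt k.
  apply: lt_trans rd; rewrite (rend_prefix _ _ wr).
  by have /andP[] := vrt k.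
exists (m_fun mu p vl).
  exact: (mh_left src rho01 step_le).
rewrite (h_funE src rho01 step_le _ F_bounds vrt).
have seriesE : series (weight vr) k.+2 = series (weight vl) k.+2.
  rewrite !seriesEord; apply: eq_bigr => -[n nk] _ /=; apply: weight_prefix.
  exact: mkseq_eqW (esym common).
have mvr : m_fun mu p vr =
    series (weight vr) k.+2 + weight vr k.+1 * (p x j * alpha j).
  rewrite (@m_fun_eventually_const _ _ _ _ src vr k.+1 ord0).
    rewrite vrj; congr (_ + _); rewrite mulrA; congr (_ * _).
    by rewrite weightS vrj /step /vr /bend ltnn eqxx.
  by move=> n kn; exact: bend_tail.
have mvl : m_fun mu p vl =
    series (weight vl) k.+2 + weight vl k.+1 * (p x i * gamma i).
  rewrite (@m_fun_eventually_const _ _ _ _ src vl k.+1 ord_max).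
    rewrite vli; congr (_ + _); rewrite mulrA; congr (_ * _).
    by rewrite weightS vli /step /vl /bend ltnn eqxx.
  by move=> n kn; exact: bend_tail.
rewrite mvl mvr seriesE (weight_prefix _ _ common) (inj_eq (addrI _)).
have wn0 : weight vr k.+1 != 0 by exact/lt0r_neq0/(weight_gt0 src).
by rewrite (inj_eq (mulfI wn0)) eq_sym.
Qed.

End jumps.

(** * Measurability and probabilities of prefix events *)

Section discrete.
Context d (Omega : measurableType d).

(** Measurability of a map into a countable set, as the measurability of its
    fibres: it is then preserved by composition with any map at all. *)
Definition discrete_rv (T : countType) (f : Omega -> T) : Prop :=
  forall t, measurable [set om | f om = t].

Lemma discrete_preimage (T : countType) (f : Omega -> T) (A : set T) :
  discrete_rv f -> measurable (f @^-1` A).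
Proof.
move=> mf; rewrite (_ : _ @^-1` _ = \bigcup_t [set om | f om = t /\ A t]); last first.
  by apply/seteqP; split=> [om Af|om [t _ /= [<- //]]]; exists (f om).
apply: countable_bigcupT_measurable; first exact: countableP.
move=> t; have [At|nAt] := pselect (A t).
  rewrite (_ : [set _ | _] = [set om | f om = t]); first exact: mf.
  by apply/seteqP; split=> om /= => [[]|].
rewrite (_ : [set _ | _] = set0); first exact: measurable0.
by apply/seteqP; split=> // om [].
Qed.

Lemma discrete_event (T : countType) (f : Omega -> T) (A : T -> bool) :
  discrete_rv f -> measurable [set om | A (f om)].
Proof. by move=> mf; exact: (discrete_preimage A mf). Qed.

Lemma discrete_comp (T U : countType) (f : Omega -> T) (g : T -> U) :
  discrete_rv f -> discrete_rv (fun om => g (f om)).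
Proof. by move=> mf u; exact: (discrete_preimage [set t | g t = u] mf). Qed.

Lemma discrete_cst (T : countType) (t : T) : discrete_rv (fun=> t).
Proof.
move=> u; have [->|tu] := eqVneq t u.
  by rewrite (_ : [set _ | _] = setT)//; apply/seteqP.
by rewrite (_ : [set _ | _] = set0)//; apply/seteqP; split=> // om /eqP; apply/negP.
Qed.

Lemma discrete_pair (T U : countType) (f : Omega -> T) (g : Omega -> U) :
  discrete_rv f -> discrete_rv g -> discrete_rv (fun om => (f om, g om)).
Proof.
move=> mf mg [t u].
rewrite (_ : [set _ | _] = [set om | f om = t] `&` [set om | g om = u]).
  by apply: measurableI; [exact: mf|exact: mg].
by apply/seteqP; split=> om /= => [[-> ->]|[-> ->]].
Qed.

Lemma discrete_map (I : Type) (s : seq I) (T : countType) (f : I -> Omega -> T) :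
  (forall i, discrete_rv (f i)) -> discrete_rv (fun om => [seq f i om | i <- s]).
Proof.
move=> mf; elim: s => [|i s IH]; first exact: discrete_cst.
exact: (discrete_comp (fun xt => xt.1 :: xt.2) (discrete_pair (mf i) IH)).
Qed.

Lemma discrete_bool (f : Omega -> bool) :
  measurable [set om | f om] -> discrete_rv f.
Proof.
move=> mf [|]; first exact: mf.
rewrite (_ : [set _ | _] = ~` [set om | f om]); first exact: measurableC.
by apply/seteqP; split=> om /= => [->//|]; move/negP/negbTE.
Qed.

Variable b : nat.

Definition random_string (X : Omega -> istring b) : Prop :=
  forall k, discrete_rv (X ^~ k).

Lemma discrete_prefix X k : random_string X -> discrete_rv (fun om => mkseq (X om) k).
Proof.
by move=> mX; apply: (@discrete_map _ (iota 0 k) _ (fun i om => X om i)) => i; exact: mX.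
Qed.

Lemma measurable_lt X Y : random_string X -> random_string Y ->
  measurable [set om | (X om < Y om)%O].
Proof.
move=> mX mY.
rewrite (_ : [set _ | _] = \bigcup_i ([set om | mkseq (X om) i = mkseq (Y om) i] `&`
    [set om | (X om i < Y om i)%N])); last first.
  apply/seteqP; split=> [om /lexlt_ltP[i vw lt]|om [i _ [/= vw lt]]].
    by exists i.
  by apply/lexlt_ltP; exists i.
apply: bigcupT_measurable => i; apply: measurableI.
- exact: (discrete_preimage [set vw | vw.1 = vw.2]
    (discrete_pair (discrete_prefix i mX) (discrete_prefix i mY))).
- exact: (discrete_event (fun vw : 'I_b * 'I_b => vw.1 < vw.2)%N (discrete_pair (mX i) (mY i))).
Qed.

Lemma measurable_le X Y : random_string X -> random_string Y ->
  measurable [set om | (X om <= Y om)%O].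
Proof.
move=> mX mY; rewrite (_ : [set _ | _] = ~` [set om | (Y om < X om)%O]).
  by apply: measurableC; exact: measurable_lt.
by apply/seteqP; split=> om /=; rewrite leNgt => /negP.
Qed.

Lemma random_string_cst w : random_string (fun=> w).
Proof. by move=> k; exact: discrete_cst. Qed.

End discrete.

Section prefix_prob.
Context (R : realType) (b : nat).
Variables (mu : 'I_b -> R) (p : 'I_b -> 'I_b -> R).
Context d (Omega : measurableType d) (P : probability Omega R).
Implicit Types (X : Omega -> istring b) (v w : istring b).
Notation weight := (weight mu p).
Notation lend := (lend mu p).
Notation rend := (rend mu p).

Lemma markov_random_string X : is_markov_chain P mu p X -> random_string X.
Proof. by move=> [mX _ _] k r; exact: mX. Qed.

Lemma measurable_prefix X k (u : seq 'I_b) : random_string X ->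
  measurable [set om | mkseq (X om) k = u].
Proof. by move=> mX; exact: discrete_prefix. Qed.

Lemma prob_prefix X k v : is_markov_chain P mu p X ->
  P [set om | mkseq (X om) k = mkseq v k] = (weight v k)%:E.
Proof.
move=> [mX X0 XS]; case: k => [|k].
  rewrite weight0 (_ : [set _ | _] = setT) ?probability_setT//.
  by apply/seteqP; split.
elim: k => [|k IH]; last by rewrite XS IH [in RHS]weightS EFinM.
rewrite (_ : [set _ | _] = [set om | X om 0%N = v 0%N]) ?X0.
  by rewrite weightS weight0 mul1r.
by apply/seteqP; split=> om /= => [[//]|e]; rewrite /mkseq /= e.
Qed.

Lemma bigsetU_ltE (T : Type) (n : nat) (F : 'I_b -> set T) :
  \big[setU/set0]_(q < b | (q < n)%N) F q = \bigcup_(q in [set q : 'I_b | (q < n)%N]) F q.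
Proof. by rewrite -(bigcup_pred [pred q : 'I_b | (q < n)%N]). Qed.

Definition prefix_below X w k : set Omega :=
  [set om | exists i, [/\ (i < k)%N, mkseq (X om) i = mkseq w i & (X om i < w i)%N]].

Lemma prefix_belowS X w k : prefix_below X w k.+1 = prefix_below X w k `|`
  \big[setU/set0]_(q < b | (q < w k)%N)
    [set om | mkseq (X om) k.+1 = mkseq (upd w k q) k.+1].
Proof.
rewrite bigsetU_ltE; apply/seteqP; split=> om.
  move=> [i [+ Xw lt]]; rewrite ltnS leq_eqVlt => /predU1P[ik|ik].
    subst i; right; exists (X om k) => //=; apply/mkseqS_eqP.
    by rewrite mkseq_upd upd_eq.
  by left; exists i.
move=> [[i [ik Xw lt]]|[q /= lt /mkseqS_eqP[Xw Xq]]].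
  by exists i; split=> //; exact: ltnW.
by exists k; split=> //; [rewrite Xw mkseq_upd|rewrite Xq upd_eq].
Qed.

(** The identity behind [lend]: it is the probability of being smaller because
    of one of the first [k] letters. *)
Lemma prob_prefix_below X w k : is_markov_chain P mu p X ->
  measurable (prefix_below X w k) /\ P (prefix_below X w k) = (lend w k)%:E.
Proof.
move=> mc; have mX := markov_random_string mc; elim: k => [|k [mB PB]].
  rewrite lend0 (_ : prefix_below _ _ _ = set0) ?measure0//.
  by apply/seteqP; split=> // om [i []].
rewrite prefix_belowS; have mq (q : 'I_b) :
  measurable [set om | mkseq (X om) k.+1 = mkseq (upd w k q) k.+1].
  exact: measurable_prefix.
split; first by apply: measurableU => //; exact: bigsetU_measurable.
rewrite measureU//; first last.
- apply/seteqP; split=> // om [[i [ik Xw lt]]].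
  rewrite bigsetU_ltE => -[q _ /= /mkseqS_eqP[]].
  rewrite mkseq_upd => /mkseq_eqP/(_ i ik) e _.
  by move: lt; rewrite e ltnn.
- exact: bigsetU_measurable.
rewrite measure_bigsetU_ord_cond//; last first.
  move=> q q' _ _ [om [/= /mkseqS_eqP[_ +] /mkseqS_eqP[_]]].
  by rewrite !upd_eq => -> .
rewrite [X in (X + _)%E]PB lendS EFinD mulr_sumr; congr (_ + _)%E.
rewrite -sumEFin; apply: eq_bigr => q _; rewrite -weight_upd; exact: prob_prefix.
Qed.

Lemma cdf_bounds X w k : is_markov_chain P mu p X ->
  lend w k <= Defs.cdf P X w <= rend w k.
Proof.
move=> mc; have mX := markov_random_string mc.
have [mB PB] := prob_prefix_below w k mc.
have mle := measurable_le mX (@random_string_cst _ Omega _ w).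
have fP A : measurable A -> P A \is a fin_num by move=> mA; exact: fin_num_measure.
rewrite -!lee_fin /Defs.cdf fineK ?fP// -PB; apply/andP; split.
  apply: le_measure; rewrite ?inE// => om [i [ik Xw lt]].
  by rewrite /= le_eqVlt; apply/orP; right; apply/lexlt_ltP; exists i.
rewrite /rend EFinD -PB -(prob_prefix k w mc).
apply: (@le_trans _ _ (P (prefix_below X w k `|` [set om | mkseq (X om) k = mkseq w k]))).
  apply: le_measure; rewrite ?inE//.
    by apply: measurableU => //; exact: measurable_prefix.
  move=> om /=; rewrite le_eqVlt => /predU1P[->|/lexlt_ltP[i Xw lt]]; first by right.
  have [ik|ki] := ltnP i k; first by left; exists i.
  by right; exact: mkseq_eqW Xw.
by apply: measureU2 => //; exact: measurable_prefix.
Qed.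

End prefix_prob.

(** * Large counts of common prefixes are unlikely *)

Section bounds.
Context (R : realType) d (Omega : measurableType d) (P : probability Omega R).

Lemma nneseries_bounded (f : nat -> \bar R) (m : R) N :
  (forall k, (N <= k)%N -> (0 <= f k)%E) ->
  (forall n, (\sum_(N <= k < n) f k <= m%:E)%E) ->
  (\sum_(N <= k <oo) f k <= m%:E)%E.
Proof.
move=> f0 fm; apply: lime_le; first by apply: is_cvg_nneseries => k ? _; exact: f0.
by apply: nearW => n; exact: fm.
Qed.

Lemma prob_bigsetU_le (I : Type) (s : seq I) (Q : pred I) (A : I -> set Omega) :
  (forall i, measurable (A i)) ->
  (P (\big[setU/set0]_(i <- s | Q i) A i) <= \sum_(i <- s | Q i) P (A i))%E.
Proof.
move=> mA; elim: s => [|i s IH]; first by rewrite !big_nil measure0.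
rewrite !big_cons; case: ifP => // _.
apply: le_trans (leeD2l _ IH); apply: measureU2 => //.
exact: bigsetU_measurable.
Qed.

Lemma prob_bigcup_le (A : nat -> set Omega) (f : nat -> R) (m : R) :
  (forall i, measurable (A i)) -> (forall i, (P (A i) <= (f i)%:E)%E) ->
  (forall n, \sum_(0 <= i < n) f i <= m) -> (P (\bigcup_i A i) <= m%:E)%E.
Proof.
move=> mA Af fm.
apply: le_trans (measure_sigma_subadditive P mA _ (@subset_refl _ _)) _.
  exact: bigcupT_measurable.
apply: nneseries_bounded => // n; apply: (@le_trans _ _ (\sum_(0 <= i < n) f i)%:E).
  by rewrite -sumEFin; apply: lee_sum => i _; exact: Af.
by rewrite lee_fin.
Qed.

Lemma geometric_sum_le (x : R) n : 0 <= x < 1 ->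
  \sum_(0 <= i < n) x ^+ i <= (1 - x)^-1.
Proof.
move=> /andP[x0 x1]; have x1' : 0 < 1 - x by rewrite subr_gt0.
rewrite -(ler_pM2r x1') mulVf ?lt0r_neq0// big_mkord mulrC.
by rewrite -[leLHS]opprK -mulNr opprB -subrX1 opprB gerDl oppr_le0 exprn_ge0.
Qed.

(** The usual bound (e n / a) ^ a of the binomial coefficient, in a form that
    includes a = 0. *)
Lemma binomial_le n a : 'C(n, a)%:R * a%:R ^+ a <= (expR 1 * n%:R) ^+ a :> R.
Proof.
rewrite exprMn -expRM_natl mulr1.
have aa : a%:R ^+ a <= expR a%:R * a`!%:R :> R.
  rewrite -ler_pdivrMr ?ltr0n ?fact_gt0//; case: a => [|a].
    by rewrite expr0 fact0 divr1 expR0.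
  apply: le_trans (expR_ge1Dxn a (ler0n _ _)).
  by rewrite lerDr.
have nn : 'C(n, a)%:R * a`!%:R <= n%:R ^+ a :> R.
  rewrite -natrM bin_ffact -natrX ler_nat ffact_prod -[a in (_ ^ a)%N]card_ord.
  rewrite -prod_nat_const; apply: leq_prod => i _; exact: leq_subr.
apply: le_trans (ler_wpM2l (ler0n _ _) aa) _.
by rewrite mulrCA ler_wpM2l// expR_ge0.
Qed.

End bounds.

Section string_events.
Variable b : nat.

Lemma prefix_event k (v : istring b) :
  string_events [set w : istring b | mkseq w k = mkseq v k].
Proof.
pose G := [set A | exists k r, A = [set w : istring b | w k = r]].
have sC A : <<s G >> A -> <<s G >> (~` A).
  by rewrite -setTD; exact: sigma_algebraCD.
have sI A B : <<s G >> A -> <<s G >> B -> <<s G >> (A `&` B).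
  move=> GA GB; rewrite -[A `&` B]setCK setCI -bigcup2E; apply: (sC _).
  apply: sigma_algebra_bigcup => -[|[|i]] /=; [exact: sC|exact: sC|].
  exact: sigma_algebra0.
elim: k => [|k IH].
  rewrite (_ : [set _ | _] = setT); last by apply/seteqP.
  by rewrite -setC0; apply: sC; exact: sigma_algebra0.
rewrite (_ : [set _ | _] = [set w : istring b | mkseq w k = mkseq v k] `&`
    [set w | w k = v k]).
  by apply: sI => //; apply: sub_sigma_algebra; exists k, (v k).
by apply/seteqP; split=> w; [move=> /mkseqS_eqP|move=> [] *; apply/mkseqS_eqP].
Qed.

(** Words of length [k], represented by strings so that [weight] applies. *)
Fixpoint prefix_strings (v0 : istring b) k : seq (istring b) :=
  if k is i.+1 then
    [seq upd v i r | v <- prefix_strings v0 i, r <- enum 'I_b]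
  else [:: v0].

Lemma prefix_strings_cover v0 k w :
  exists2 v, v \in prefix_strings v0 k & mkseq v k = mkseq w k.
Proof.
elim: k => [|k [v vin vw]]; first by exists v0 => //=; rewrite mem_seq1.
exists (upd v k (w k)); last by apply/mkseqS_eqP; rewrite mkseq_upd upd_eq.
by apply/allpairsP; exists (v, w k); rewrite /= mem_enum.
Qed.

End string_events.

Section crowding.
Context (R : realType) (b : nat).
Variables (mu : 'I_b -> R) (p : 'I_b -> 'I_b -> R).
Context d (Omega : measurableType d) (P : probability Omega R).
Variable S : nat -> Omega -> istring b.
Hypothesis src : source_params mu p.
Hypothesis mc : forall i, is_markov_chain P mu p (S i).
Hypothesis indep : independent_strings P S.
Notation weight := (weight mu p).

Lemma sum_prefix_strings v0 k :
  \sum_(v <- prefix_strings v0 k) weight v k = 1.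
Proof.
elim: k => [|k IH]; first by rewrite big_seq1 weight0.
rewrite big_allpairs_dep /= -[RHS]IH; apply: eq_bigr => v _.
rewrite -[RHS]mulr1 -(sum_step src v k) mulr_sumr big_enum.
by apply: eq_bigr => r _; rewrite weight_upd.
Qed.

Lemma prob_common_prefix (J : seq nat) k v : uniq J ->
  P (\big[setI/setT]_(i <- J) [set om | mkseq (S i om) k = mkseq v k]) =
  (weight v k ^+ size J)%:E.
Proof.
move=> uJ.
have := indep (A := fun=> [set w | mkseq w k = mkseq v k]) uJ (fun i _ => prefix_event k v).
move=> /= ->; rewrite (eq_bigr (fun=> (weight v k)%:E)); last first.
  by move=> i _; exact: prob_prefix.
elim: J {uJ} => [|i J IH]; first by rewrite big_nil expr0.
by rewrite big_cons IH /= exprS EFinM.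
Qed.

Lemma random_sample i : random_string (S i).
Proof. exact: markov_random_string. Qed.

Definition shared (J : seq nat) k : set Omega :=
  [set om | exists u, forall i, i \in J -> mkseq (S i om) k = u].

Lemma measurable_shared J k : measurable (shared J k).
Proof.
have mS := @discrete_map _ _ _ J _ _ (fun i => discrete_prefix k (@random_sample i)).
rewrite (_ : shared J k = [set om | exists u,
    {in [seq mkseq (S i om) k | i <- J], forall w, w = u}]); last first.
  apply/seteqP; split=> om [u ue]; exists u.
    by move=> w /mapP[i iJ ->]; exact: ue.
  by move=> i iJ; apply: ue; apply/mapP; exists i.
exact: (discrete_preimage [set l : seq (seq 'I_b) | exists u, {in l, forall w, w = u}] mS).
Qed.

Variable rho : R.
Hypothesis rho01 : 0 < rho < 1.
Hypothesis step_le : forall v j q, step mu p v j q <= rho.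

(** The sum of [weight v k ^+ a.+1] over all words is at most the largest
    weight to the power [a], times the sum 1 of the weights. *)
Lemma prob_shared (J : seq nat) k a : uniq J -> size J = a.+1 ->
  (P (shared J k) <= (rho ^+ k ^+ a)%:E)%E.
Proof.
move=> uJ sJ.
have [v0 _] : exists v0 : istring b, True.
  apply: contrapT => nv; have e : @setT Omega = set0.
    by apply/seteqP; split=> // om _; apply: nv; exists (S 0%N om).
  by have := probability_setT P; rewrite e measure0 => /eqP; rewrite eq_sym onee_eq0.
have [i0 i0J] : exists i, i \in J.
  by case: J sJ {uJ} => // i J' _; exists i; rewrite inE eqxx.
pose A v := \big[setI/setT]_(i <- J) [set om | mkseq (S i om) k = mkseq v k].
have mA v : measurable (A v).
  by apply: bigsetI_measurable => i _; exact/measurable_prefix/random_sample.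
apply: (@le_trans _ _ (P (\big[setU/set0]_(v <- prefix_strings v0 k) A v))).
  apply: le_measure; rewrite ?inE; first exact: measurable_shared.
    exact: bigsetU_measurable.
  move=> om [u uS]; rewrite -bigcup_seq.
  have [v vin vE] := prefix_strings_cover v0 k (S i0 om).
  exists v => //; rewrite /A -bigcap_seq => i iJ /=.
  by rewrite vE !uS.
apply: le_trans (prob_bigsetU_le _ _ _ mA) _.
under eq_bigr do rewrite /A prob_common_prefix// sJ.
rewrite sumEFin lee_fin -[leRHS]mulr1 -(sum_prefix_strings v0 k) mulr_sumr.
apply: ler_sum => v _; rewrite exprSr ler_wpM2r ?(ltW (weight_gt0 src _ _))//.
rewrite lerXn2r ?nnegrE ?(ltW (weight_gt0 src _ _)) ?exprn_ge0 ?(weight_le src)//.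
by case/andP: rho01 => /ltW.
Qed.

Definition crowded n k a : set Omega :=
  [set om | exists v, (a <= Lambda (S^~ om) n k v)%N].

Lemma LambdaE (s : nat -> istring b) n k v :
  Lambda s n k v = count (fun i => mkseq v k == mkseq (s i) k) (iota 0 n).
Proof. by rewrite /Lambda /mkseq count_map; apply: eq_count => i /=; rewrite lcp_geE. Qed.

Lemma measurable_crowded n k a : measurable (crowded n k a).
Proof.
have mS := @discrete_map _ _ _ (iota 0 n) _ _ (fun i => discrete_prefix k (@random_sample i)).
rewrite (_ : crowded n k a = [set om | exists v : istring b,
    (a <= count (eq_op (mkseq v k)) [seq mkseq (S i om) k | i <- iota 0 n])%N]).
  exact: (discrete_preimage [set l : seq (seq 'I_b) | exists v : istring b,
    (a <= count (eq_op (mkseq v k)) l)%N] mS).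
by apply/seteqP; split=> om [v va]; exists v; move: va; rewrite LambdaE count_map.
Qed.

(** A union bound over the possible sets of indices of [a.+1] strings with a
    common prefix. *)
Lemma prob_crowded n k a :
  (P (crowded n k a.+1) <= ('C(n, a.+1)%:R * rho ^+ k ^+ a)%:E)%E.
Proof.
pose idx (J : {set 'I_n}) := [seq val i | i <- enum J].
have uidx J : uniq (idx J) by rewrite map_inj_uniq ?enum_uniq//; exact: val_inj.
apply: (@le_trans _ _ (P (\big[setU/set0]_(J : {set 'I_n} | #|J| == a.+1) shared (idx J) k))).
  apply: le_measure; rewrite ?inE; first exact: measurable_crowded.
    by apply: bigsetU_measurable => J _; exact: measurable_shared.
  move=> om [v]; rewrite LambdaE -val_enum_ord count_map -size_filter.
  set t := seq.filter _ _ => at_.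
  have ut : uniq (take a.+1 t) by rewrite take_uniq// filter_uniq// enum_uniq.
  rewrite (bigD1 [set i in take a.+1 t]%SET) /=; last first.
    by rewrite cardsE (card_uniqP ut) size_takel.
  left; exists (mkseq v k) => _ /mapP[i + ->].
  by rewrite mem_enum inE => /mem_take; rewrite mem_filter => /andP[/eqP].
apply: le_trans (prob_bigsetU_le _ _ _ _) _.
  by move=> J; exact: measurable_shared.
apply: (@le_trans _ _ (\sum_(J : {set 'I_n} | #|J| == a.+1) (rho ^+ k ^+ a)%:E)).
  apply: lee_sum => J /eqP Ja; apply: prob_shared => //.
  by rewrite size_map -cardE.
rewrite sumEFin lee_fin sumr_const -[X in 'C(X, _)]card_ord -card_draws.
by rewrite cardsE mulr_natl.
Qed.

End crowding.

(** * Deep common prefixes contribute little to the number of bucket operations *)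

Section deep_prefixes.
Context (R : realType) (b : nat).
Variables (mu : 'I_b -> R) (p : 'I_b -> 'I_b -> R).
Context d (Omega : measurableType d) (P : probability Omega R).
Variable S : nat -> Omega -> istring b.
Hypothesis src : source_params mu p.
Hypothesis mc : forall i, is_markov_chain P mu p (S i).
Hypothesis indep : independent_strings P S.
Variable th : R.
Hypothesis th01 : 0 < th < 1.
Hypothesis step_le : forall v j q, step mu p v j q <= th ^+ 4.

Let th_gt0 : 0 < th. Proof. by case/andP: th01. Qed.
Let th_lt1 : th < 1. Proof. by case/andP: th01. Qed.
Let th_ge0 : 0 <= th. Proof. exact: ltW. Qed.

(** As long as no word of length [k] is the prefix of [crowd n k] strings, the
    term of depth [k] in [Zn] is at most [th ^+ k * n], which is summable over
    [k]. Counts below 2 may be disregarded as they do not enter [Zn]. *)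
Definition crowd n k : nat := maxn 2 (Num.truncn (th ^+ k * n%:R)).+1.

Lemma crowd_ge2 n k : (2 <= crowd n k)%N.
Proof. exact: leq_maxl. Qed.

Lemma crowd_gt n k : th ^+ k * n%:R < (crowd n k)%:R.
Proof.
apply: lt_le_trans (truncnS_gt _) _.
by rewrite ler_nat leq_maxr.
Qed.

(** The fourth power in the bound on the transition probabilities leaves one
    factor [th ^+ k] per string, after compensating for the binomial coefficient
    and for the exponent in [prob_crowded], one less than the number of
    strings. *)
Lemma prob_crowded_le n k :
  (P (crowded S n k (crowd n k)) <= ((expR 1 * th ^+ k) ^+ crowd n k)%:E)%E.
Proof.
have th4 : 0 < th ^+ 4 < 1 by rewrite exprn_gt0// exprn_ilt1.
have := crowd_ge2 n k; have := crowd_gt n k.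
case: (crowd n k) => // a; set A := a.+1 => nA A2.
apply: le_trans (prob_crowded src mc indep th4 step_le _ _ _) _.
rewrite lee_fin -/A; have A0 : 0 < A%:R ^+ A :> R by rewrite exprn_gt0// ltr0n.
have tk0 : 0 <= th ^+ k by exact: exprn_ge0.
rewrite -(ler_pM2r A0) mulrAC; apply: le_trans (ler_wpM2r _ (binomial_le _ _ _)) _.
  by rewrite !exprn_ge0.
have pw : th ^+ 4 ^+ k ^+ a <= th ^+ k ^+ A * th ^+ k ^+ A.
  rewrite -!exprM -exprD ler_wiXn2l ?(ltW th_lt1)//.
  by rewrite /A in A2 *; nia.
apply: (@le_trans _ _ ((expR 1 * n%:R) ^+ A * (th ^+ k ^+ A * th ^+ k ^+ A))).
  by rewrite ler_wpM2l// exprn_ge0// mulr_ge0// expR_ge0.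
have -> : (expR 1 * n%:R) ^+ A * (th ^+ k ^+ A * th ^+ k ^+ A) =
    (expR 1 * th ^+ k) ^+ A * (th ^+ k * n%:R) ^+ A.
  by move: (th ^+ k) => y; rewrite !exprMn mulrACA [n%:R ^+ A * _]mulrC.
rewrite ler_wpM2l ?exprn_ge0 ?mulr_ge0 ?expR_ge0//.
by rewrite lerXn2r ?nnegrE ?mulr_ge0// ltW.
Qed.

Definition deep_crowd n K : set Omega :=
  \bigcup_j crowded S n (K + j) (crowd n (K + j)).

Lemma measurable_deep_crowd n K : measurable (deep_crowd n K).
Proof. by apply: bigcupT_measurable => j; exact: (measurable_crowded mc). Qed.

Lemma expR_th_small (e : R) : 0 < e -> exists K, expR 1 * th ^+ K <= e.
Proof.
move=> e0; have [K Ke] := rho_small th01 (divr_gt0 e0 (expR_gt0 1)).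
by exists K; rewrite mulrC -ler_pdivlMr ?expR_gt0// ltW.
Qed.

Lemma prob_deep_crowd_le n K : expR 1 * th ^+ K <= 1 ->
  (P (deep_crowd n K) <= (expR 1 * th ^+ K / (1 - th))%:E)%E.
Proof.
move=> K1; apply: (@prob_bigcup_le _ _ _ _ _ (fun j => expR 1 * th ^+ K * th ^+ j)).
- by move=> j; exact: (measurable_crowded mc).
- move=> j; apply: le_trans (prob_crowded_le _ _) _.
  rewrite lee_fin -mulrA -exprD; set x := expR 1 * _.
  have x0 : 0 <= x by rewrite mulr_ge0 ?expR_ge0// exprn_ge0.
  have x1 : x <= 1.
    apply: le_trans K1; rewrite ler_wpM2l ?expR_ge0// ler_wiXn2l ?(ltW th_lt1)//.
    exact: leq_addr.
  case: crowd (crowd_ge2 n (K + j)) => // a _.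
  by rewrite exprS ler_piMr// exprn_ile1.
- move=> N; rewrite -mulr_sumr ler_wpM2l ?mulr_ge0 ?expR_ge0 ?exprn_ge0//.
  by rewrite geometric_sum_le// th_ge0.
Qed.

(** At each fixed depth the bound on the probability decreases exponentially
    with n, while the sum over large depths is small uniformly in n. *)
Lemma prob_deep_crowd_cvg0 K : expR 1 * th ^+ K <= 2^-1 ->
  forall e : R, 0 < e -> exists n0, forall n, (n0 <= n)%N ->
    (P (deep_crowd n K) <= e%:E)%E.
Proof.
move=> K2 e e0; have e2 : 0 < e / 2 by rewrite divr_gt0.
have th' : 0 < 1 - th by rewrite subr_gt0.
pose e' := Num.min 1 (e / 2 * (1 - th)).
have e'0 : 0 < e' by rewrite lt_min ltr01 mulr_gt0.
have [L Le] := expR_th_small e'0.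
have L1 : expR 1 * th ^+ (K + L) <= e'.
  apply: le_trans Le; rewrite ler_wpM2l ?expR_ge0// ler_wiXn2l ?(ltW th_lt1)//.
  exact: leq_addl.
have far n : (P (deep_crowd n (K + L)) <= (e / 2)%:E)%E.
  apply: le_trans (prob_deep_crowd_le _ _) _.
    by apply: le_trans L1 _; rewrite /e' ge_min lexx.
  rewrite lee_fin ler_pdivrMr//; apply: le_trans L1 _.
  by rewrite /e' ge_min lexx orbT.
have [N Nsmall] : exists N : nat, L%:R * 2^-1 ^+ N <= e / 2 :> R.
  have half : 0 < (2^-1 : R) < 1 by rewrite invr_gt0 ltr0n invf_lt1 ?ltr0n// ltr1n.
  have Lp : 0 < e / 2 / L.+1%:R by rewrite divr_gt0// ltr0n.
  have [N hN] := rho_small half Lp; exists N.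
  have h0 : 0 <= 2^-1 ^+ N :> R by rewrite exprn_ge0// invr_ge0.
  apply: (@le_trans _ _ (L.+1%:R * 2^-1 ^+ N)); first by rewrite ler_wpM2r// ler_nat.
  by rewrite mulrC -ler_pdivlMr ?ltr0n// ltW.
exists (Num.truncn (N%:R / th ^+ (K + L))).+1 => n nN.
have crowdN j : (j < L)%N -> (N <= crowd n (K + j))%N.
  move=> jL; rewrite -(ler_nat R) ltW//; apply: le_lt_trans (crowd_gt _ _).
  apply: (@le_trans _ _ (th ^+ (K + L) * n%:R)).
    rewrite mulrC -ler_pdivrMr ?exprn_gt0// (le_trans (ltW (truncnS_gt _)))//.
    by rewrite ler_nat.
  by rewrite ler_wpM2r// ler_wiXn2l ?(ltW th_lt1)// leq_add2l ltnW.
pose near_part := \big[setU/set0]_(0 <= j < L) crowded S n (K + j) (crowd n (K + j)).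
have mnear : measurable near_part.
  by apply: bigsetU_measurable => j _; exact: (measurable_crowded mc).
have near_le : (P near_part <= (e / 2)%:E)%E.
  apply: le_trans (prob_bigsetU_le _ _ _ _) _.
    by move=> j; exact: (measurable_crowded mc).
  apply: (@le_trans _ _ (\sum_(0 <= j < L) (2^-1 ^+ N)%:E)%E).
    rewrite big_nat_cond [leRHS]big_nat_cond; apply: lee_sum => j; rewrite andbT => /andP[_ jL].
    apply: le_trans (prob_crowded_le _ _) _; rewrite lee_fin.
    have x0 : 0 <= expR 1 * th ^+ (K + j) by rewrite mulr_ge0 ?expR_ge0// exprn_ge0.
    have x2 : expR 1 * th ^+ (K + j) <= 2^-1.
      apply: le_trans K2; rewrite ler_wpM2l ?expR_ge0// ler_wiXn2l ?(ltW th_lt1)//.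
      exact: leq_addr.
    apply: (@le_trans _ _ (2^-1 ^+ crowd n (K + j))).
      by rewrite lerXn2r ?nnegrE ?invr_ge0.
    by rewrite ler_wiXn2l ?crowdN ?invr_ge0 ?invf_le1 ?ltr0n ?ler1n.
  by rewrite sumEFin lee_fin sumr_const_nat subn0 -[leLHS]mulr_natl.
apply: (@le_trans _ _ (P (near_part `|` deep_crowd n (K + L)))).
  apply: le_measure; rewrite ?inE; first exact: measurable_deep_crowd.
    by apply: measurableU => //; exact: measurable_deep_crowd.
  move=> om [j _ cj]; have [jL|Lj] := ltnP j L.
    by left; rewrite /near_part -bigcup_seq; exists j => //=; rewrite mem_index_iota.
  by right; exists (j - L)%N => //; rewrite -addnA subnKC.
apply: le_trans (measureU2 _ mnear (measurable_deep_crowd _ _)) _.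
by rewrite [e]splitr EFinD; apply: leeD; [exact: near_le|exact: far].
Qed.

Lemma Lambda_prefix (s : nat -> istring b) n k K v w :
  (k <= K)%N -> mkseq v K = mkseq w K -> Lambda s n k v = Lambda s n k w.
Proof. by move=> kK vw; rewrite !LambdaE (mkseq_eqW kK vw). Qed.

(** The terms up to depth [K] agree, and the remaining ones form at most a
    geometric series. *)
Lemma Zn_close (s : nat -> istring b) n K :
  (forall k v, (K <= k)%N -> (Lambda s n k v < crowd n k)%N) ->
  forall v w, mkseq v K = mkseq w K ->
  `|fine (Zn R s n v) - fine (Zn R s n w)| <= n%:R * th ^+ K / (1 - th).
Proof.
move=> few v w vw; pose f u k : \bar R :=
  if (1 < Lambda s n k u)%N then (Lambda s n k u)%:R%:E else 0%E.
pose C : R := n%:R * th ^+ K / (1 - th).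
have f0 u k : (0 <= f u k)%E by rewrite /f; case: ifP => // _; rewrite lee_fin.
have tail u : (\sum_(K <= k <oo) f u k <= C%:E)%E.
  apply: nneseries_bounded => // N.
  apply: (@le_trans _ _ (\sum_(K <= k < N) (n%:R * th ^+ k)%:E)%E).
    rewrite big_nat_cond [leRHS]big_nat_cond; apply: lee_sum => k; rewrite andbT => /andP[Kk _].
    rewrite /f; case: ifP => [L1|_]; last by rewrite lee_fin mulr_ge0// exprn_ge0.
    rewrite lee_fin; have := few k u Kk; rewrite /crowd leq_max.
    rewrite !ltnS leqNgt L1 /= => L2.
    rewrite mulrC; apply: (@le_trans _ _ (Num.truncn (th ^+ k * n%:R))%:R).
      by rewrite ler_nat.
    by rewrite truncn_le mulr_ge0// exprn_ge0.
  rewrite sumEFin lee_fin -mulr_sumr /C -mulrA ler_wpM2l//.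
  have [NK|KN] := leqP N K; first by rewrite big_geq// mulr_ge0 ?exprn_ge0// invr_ge0 subr_ge0 ltW.
  rewrite -{1}[K]add0n big_addn.
  rewrite (eq_bigr (fun i => th ^+ K * th ^+ i)) => [|i _]; last by rewrite addnC exprD.
  by rewrite -mulr_sumr ler_wpM2l ?exprn_ge0// geometric_sum_le// th_ge0.
have ZE u : Zn R s n u = (\sum_(0 <= k < K) f u k + \sum_(K <= k <oo) f u k)%E.
  by rewrite /Zn (nneseries_split 0 K) ?add0n// => k _; exact: (f0 u).
have head : (\sum_(0 <= k < K) f v k = \sum_(0 <= k < K) f w k)%E.
  apply: eq_big_nat => k /andP[_ kK].
  by rewrite /f (Lambda_prefix s n (ltnW kK) vw).
have fin_head u : (\sum_(0 <= k < K) f u k)%E \is a fin_num.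
  by apply/sum_fin_numP => k _ _; rewrite /f; case: ifP.
have tail0 u : (0 <= \sum_(K <= k <oo) f u k)%E by apply: nneseries_ge0 => k _ _.
have fin_tail u : (\sum_(K <= k <oo) f u k)%E \is a fin_num.
  by rewrite ge0_fin_numE// (le_lt_trans (tail u)) ?ltry.
rewrite !ZE head !fineD// opprD addrACA subrr add0r.
have tv := tail v; have tw := tail w.
rewrite -(fineK (fin_tail v)) lee_fin in tv.
rewrite -(fineK (fin_tail w)) lee_fin in tw.
have tv0 := fine_ge0 (tail0 v); have tw0 := fine_ge0 (tail0 w).
rewrite ler_norml -/C; apply/andP; split; lra.
Qed.

End deep_prefixes.

(** * Cadlag functions and compact subsets of the Skorokhod space *)

Section cadlag.
Context (R : realType) (c d : R).
Implicit Types f g : R -> R.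

Lemma cadlag_lin f g (a k : R) : cadlag c d f -> cadlag c d g ->
  cadlag c d (fun t => (f t - g t * a) / k).
Proof.
move=> [fr fl] [gr gl].
have lin (F : set_system R) (FF : Filter F) (x y : R) : f t @[t --> F] --> x ->
    g t @[t --> F] --> y -> (f t - g t * a) / k @[t --> F] --> (x - y * a) / k.
  move=> fx gy; apply: cvgM; last exact: cvg_cst.
  by apply: cvgB => //; apply: cvgM => //; exact: cvg_cst.
split=> t tcd; first by apply: lin; [exact: fr|exact: gr].
have /cvg_ex[x fx] := fl _ tcd; have /cvg_ex[y gy] := gl _ tcd.
by apply/cvg_ex; exists ((x - y * a) / k); exact: lin.
Qed.

Lemma cadlag_truncn (g : nat -> R) n : 0 <= c ->
  cadlag c d (fun t => g (Num.truncn (t * n%:R))).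
Proof.
move=> c0; have [->|n0] := posnP n.
  by split=> t _; rewrite ?mulr0;
    [apply: cvg_near_cst|apply: is_cvg_near_cst]; apply: nearW => x; rewrite !mulr0.
have nR : 0 < n%:R :> R by rewrite ltr0n.
split=> t /andP[ct td].
  have t0 : 0 <= t by exact: le_trans ct.
  apply: cvg_near_cst; near=> x.
  have tx : t <= x by near: x; exact: nbhs_right_ge.
  congr g; apply/truncn_def/andP; split.
    apply: (@le_trans _ _ (t * n%:R)); last by rewrite ler_wpM2r// ltW.
    by rewrite truncn_le mulr_ge0// ltW.
  rewrite -ltr_pdivlMr//; near: x; apply: nbhs_right_lt.
  by rewrite ltr_pdivlMr// truncnS_gt.
have t0 : 0 < t by exact: le_lt_trans ct.
have exm : exists m, t * n%:R <= m%:R.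
  by exists (Num.truncn (t * n%:R)).+1; exact/ltW/truncnS_gt.
have [[|q] tq minq] := ex_minnP exm.
  by move: tq; rewrite leNgt mulr_gt0.
have qt : q%:R < t * n%:R by rewrite ltNge; apply/negP => /minq; rewrite ltnn.
apply: (@is_cvg_near_cst _ _ (g q)); near=> x.
congr g; apply/truncn_def/andP; split.
  rewrite -ler_pdivrMr//; near: x; apply: nbhs_left_ge.
  by rewrite ltr_pdivrMr.
by apply: lt_le_trans tq; rewrite ltr_pM2r.
Unshelve. all: by end_near. Qed.

(** Near each point the one-sided limits provide a bound; compactness of the
    interval makes it uniform. *)
Lemma cadlag_bounded f : cadlag c d f ->
  exists M : R, forall t, t \in `[c, d] -> `|f t| <= M.
Proof.
move=> [fr fl].
have /compact_near_coveringP cover := @segment_compact R c d.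
have near1 (F : set_system R) (FF : Filter F) (l : R) : f x @[x --> F] --> l ->
    \forall x \near F, `|f x| <= `|l| + 1.
  move=> /cvgrPdist_le/(_ 1 ltr01) fF; apply: filterS fF => x lx.
  rewrite -[f x](subrK l) addrC (le_trans (ler_normD _ _))//.
  by rewrite lerD2l distrC.
have [M _ bM] : \forall i \near \oo, `[c, d]%classic `<=`
    [set t | t \in `[c, d] -> `|f t| <= i%:R].
  apply: (cover _ \oo (fun i => [set t | t \in `[c, d] -> `|f t| <= i%:R])).
  move=> t; rewrite /= in_itv /= => /andP[ct td].
  have [r rt] : exists r : R, \forall x \near t, t < x -> x <= d -> `|f x| <= r.
    move: td; rewrite le_eqVlt => /predU1P[td|td].
      by exists 0; near=> x => tx xd; move: tx; rewrite td ltNge xd.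
    have fc : f x @[x --> t^'+] --> f t by apply: fr; rewrite ct.
    have near_right := near1 _ _ _ fc; rewrite near_withinE in near_right.
    exists (`|f t| + 1); near=> x => tx _.
    by move: tx; near: x; exact: near_right.
  have [l lt] : exists l : R, \forall x \near t, x < t -> c <= x -> `|f x| <= l.
    move: ct; rewrite le_eqVlt => /predU1P[ct|ct].
      by exists 0; near=> x => xt cx; move: xt; rewrite -ct ltNge cx.
    have /cvg_ex[y fc] : cvg (f x @[x --> t^'-]) by apply: fl; rewrite ct.
    have near_left := near1 _ _ _ fc; rewrite near_withinE in near_left.
    exists (`|y| + 1); near=> x => xt _.
    by move: xt; near: x; exact: near_left.
  exists ([set x | (t < x -> x <= d -> `|f x| <= r) /\ (x < t -> c <= x -> `|f x| <= l)],
      [set i | Num.max r (Num.max l `|f t|) <= i%:R]).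
    by split; [exact: filterI rt lt|exact: nbhs_infty_ger].
  move=> [x i] [/= [xr xl] imax]; rewrite in_itv /= => /andP[cx xd].
  apply: le_trans imax; rewrite !le_max.
  have [xt|tx|->] := ltgtP x t; last by rewrite lexx !orbT.
  - by rewrite xl ?orbT.
  - by rewrite xr.
by exists M%:R => t tcd; exact: (bM M (leqnn M)).
Unshelve. all: by end_near. Qed.

(** A time change is onto, so that uniform boundedness is preserved within a
    ball of radius 1. *)
Lemma compact_skorokhod_bounded (K : set (skorokhod c d)) : compact K ->
  exists M : R, forall x, K x -> forall t, t \in `[c, d] -> `|x t| <= M.
Proof.
move=> /compact_near_coveringP cover.
have [M _ bM] : \forall i \near \oo, K `<=`
    [set x | forall t, t \in `[c, d] -> `|x t| <= i%:R].
  apply: (cover _ \oo (fun i => [set x : skorokhod c d |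
    forall t, t \in `[c, d] -> `|x t| <= i%:R])).
  move=> x _; have /asboolP[/cadlag_bounded[m bm] _] := valP x.
  exists (ball x 1, [set i | m + 1 <= i%:R]).
    split; first exact: nbhsx_ballx.
    exact: nbhs_infty_ger.
  move=> [y i] [/= [e' e1 [lam [_ im _] xy]] mi] t tcd.
  have [u ucd <-] : (lam @` `[c, d]%classic) t by rewrite im.
  have [_ xyu] := xy u ucd; apply: le_trans mi.
  rewrite -[y _](subKr (x u)) (le_trans (ler_normB _ _))// lerD ?bm//.
  exact: le_trans (ltW e1).
by exists M%:R => x Kx; exact: (bM M (leqnn M)).
Qed.

End cadlag.

(** * Neighbouring order statistics with different prefixes *)

Section above.
Variable b : nat.
Implicit Types x y v w z : istring b.

Definition above K x w : bool :=
  [exists i : 'I_K, (mkseq x i == mkseq w i) && (x i < w i)%N].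

Lemma aboveP K x w : reflect
  (exists i, [/\ (i < K)%N, mkseq x i = mkseq w i & (x i < w i)%N]) (above K x w).
Proof.
apply: (iffP existsP) => [[i /andP[/eqP xw lt]]|[i [iK /eqP xw lt]]].
  by exists i.
by exists (Ordinal iK); rewrite /= xw.
Qed.

Lemma above_lt K x w : above K x w -> (x < w)%O.
Proof. by move=> /aboveP[i [_ xw lt]]; apply/lexlt_ltP; exists i. Qed.

Lemma above_prefix K x x' : mkseq x K = mkseq x' K -> above K x =1 above K x'.
Proof.
move=> xx' w; apply: eq_existsb => -[i iK] /=.
by rewrite (mkseq_eqW (ltnW iK) xx') (mkseq_eqP x x' K).1.
Qed.

Lemma above_of_lt K x y : (x <= y)%O -> mkseq x K <> mkseq y K -> above K x y.
Proof.
rewrite le_eqVlt => /predU1P[->//|/lexlt_ltP[i xy lt] nxy].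
apply/aboveP; exists i; split=> //; rewrite ltnNge; apply/negP => Ki.
by apply: nxy; exact: mkseq_eqW Ki xy.
Qed.

Lemma above_le K x y w : above K x y -> (y <= w)%O -> above K x w.
Proof.
move=> xy yw; have xlty := above_lt xy.
apply: above_of_lt; first exact: le_trans (ltW xlty) yw.
move=> xw; move/aboveP : xy => [i [iK xyi lt]].
have lt' : (w < y)%O.
  apply/lexlt_ltP; exists i; first by rewrite -(mkseq_eqW (ltnW iK) xw).
  by rewrite -((mkseq_eqP x w K).1 xw i iK).
by move: (lt_le_trans lt' yw); rewrite ltxx.
Qed.

Lemma above_top K x y z : (forall j, (j < K)%N -> z j = b.-1 :> nat) ->
  above K x y -> above K x z.
Proof.
move=> ztop xy; have le_top (i : 'I_b) : (i <= b.-1)%N by case: i => -[|i] ib /=; lia.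
apply: (above_of_lt (K := K)).
  rewrite leNgt; apply/negP => /lexlt_ltP[i zx lt].
  have [iK|Ki] := ltnP i K.
    by move: lt; rewrite ztop// ltnNge le_top.
  move/aboveP : xy => [j [jK _ lt']].
  have := (mkseq_eqP z x i).1 zx j (leq_trans jK Ki) => e.
  have := leq_trans lt' (le_top _); rewrite -e ztop//; lia.
move=> xz; move/aboveP : xy => [j [jK _ lt']].
have e := (mkseq_eqP x z K).1 xz j jK.
have := leq_trans lt' (le_top _); rewrite e ztop//; lia.
Qed.

(** If two neighbouring order statistics differ within the first [K] letters,
    the strings up to the lower one are exactly those which these letters do not
    place above it. So the rank is determined by the prefix of the lower one. *)
Lemma count_order_stat (s : nat -> istring b) n l K : (0 < l < n)%N ->
  mkseq (order_stat s n l) K <> mkseq (order_stat s n l.+1) K ->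
  above K (order_stat s n l) (order_stat s n l.+1) /\
  count (predC (above K (order_stat s n l))) (mkseq s n) = l.
Proof.
move=> /andP[l0 ln]; rewrite /order_stat /=.
set t := sort _ _; set x := nth _ t l.-1; set y := nth _ t l => nxy.
have st : size t = n by rewrite size_sort size_mkseq.
have le_t : sorted <=%O t by apply: sort_sorted; exact: le_total.
have mono i j : (i <= j)%N -> (j < n)%N -> (nth (s 0%N) t i <= nth (s 0%N) t j)%O.
  by move=> ij jn; apply: (sorted_leq_nth le_trans lexx) => //; rewrite inE st// (leq_ltn_trans ij).
have xy : above K x y.
  by apply: above_of_lt => //; apply: mono => //; exact: leq_pred.
split=> //; have -> : count (predC (above K x)) (mkseq s n) = count (predC (above K x)) t.
  by apply/permP; rewrite perm_sym perm_sort.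
rewrite -[in LHS](cat_take_drop l t) count_cat.
have -> : count (predC (above K x)) (take l t) = l.
  rewrite -[RHS](_ : size (take l t) = l); last by rewrite size_takel// st ltnW.
  apply/eqP; rewrite -all_count; apply/(all_nthP (s 0%N)) => i.
  rewrite size_takel ?st ?(ltnW ln)// => il; rewrite nth_take//=.
  apply/negP => /above_lt; rewrite ltNge => /negP; apply; apply: mono; lia.
rewrite [X in (_ + X)%N](_ : _ = 0%N) ?addn0//.
apply/eqP; rewrite -leqn0 leqNgt -has_count -all_predC; apply/(all_nthP (s 0%N)) => i.
rewrite size_drop st => il; rewrite nth_drop /= negbK.
by apply: (above_le xy); apply: mono; lia.
Qed.

(** There are only [b ^ K] possible prefixes of the strings [x j]. The strings
    after the first [n0] ones begin with the largest possible prefix, so that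
    they lie above each [x j], and [l j] depends on the prefix of [x j] only. *)
Lemma prefix_pigeonhole (s : nat -> istring b) (x y : nat -> istring b)
    (l : nat -> nat) K N n0 k : (b ^ K <= N)%N ->
  (forall i, (n0 <= i < n0 + N * k)%N ->
    forall j, (j < K)%N -> s i j = b.-1 :> nat) ->
  (forall j, (j <= N)%N -> above K (x j) (y j) /\
    count (predC (above K (x j))) (mkseq s (n0 + j * k)) = l j) ->
  ~ (forall i j, (i <= N)%N -> (j <= N)%N -> l i = l j -> i = j).
Proof.
move=> bN top cnt linj.
pose pre (j : 'I_N.+1) : K.-tuple 'I_b := mktuple (fun i => x j i).
have preE j j' : pre j = pre j' -> mkseq (x j) K = mkseq (x j') K.
  move=> e; apply/mkseq_eqP => i iK.
  by have := congr1 (fun u => tnth u (Ordinal iK)) e; rewrite !tnth_mktuple.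
have lE (j : 'I_N.+1) : l j = count (predC (above K (x j))) (mkseq s n0).
  have jb : (j <= N)%N by rewrite -ltnS.
  have [xy <-] := cnt j jb; rewrite /mkseq iotaD map_cat count_cat add0n.
  rewrite [X in (_ + X)%N](_ : _ = 0%N) ?addn0//.
  apply/eqP; rewrite -leqn0 leqNgt -has_count -all_predC; apply/allP => w.
  move=> /mapP[i]; rewrite mem_iota => /andP[n0i i_lt] ->; rewrite /= negbK.
  apply: above_top xy; apply: top; rewrite n0i /= (leq_trans i_lt)//.
  by rewrite leq_add2l leq_mul2r jb orbT.
have pre_inj : injective pre.
  have jN (j : 'I_N.+1) : (j <= N)%N by rewrite -ltnS.
  move=> j j' e; apply: val_inj; apply: linj; [exact: jN|exact: jN|].
  by rewrite !lE; apply: eq_count => w /=; rewrite (above_prefix (preE _ _ e)).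
have := leq_card _ pre_inj; rewrite card_ord card_tuple card_ord.
by rewrite leqNgt ltnS bN.
Qed.

End above.

(** * Measurability of the process *)

Section measurability.
Context (R : realType) (b : nat).
Context d (Omega : measurableType d).
Variable S : nat -> Omega -> istring b.
Hypothesis mS : forall i, random_string (S i).

Lemma discrete_Lambda n k i :
  discrete_rv (fun om => Lambda (S^~ om) n k (S i om)).
Proof.
have mprefixes : discrete_rv (fun om => [seq mkseq (S j om) k | j <- iota 0 n]).
  by apply: discrete_map => j; exact: discrete_prefix.
have := discrete_comp (fun ul => count (eq_op ul.1) ul.2)
  (discrete_pair (discrete_prefix k (mS i)) mprefixes).
congr discrete_rv; apply/funext => om.
by rewrite LambdaE /= count_map.
Qed.

Lemma measurable_Zn n i :
  measurable_fun setT (fun om => Zn R (S^~ om) n (S i om) : \bar R).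
Proof.
apply: ge0_emeasurable_sum => [k om _ _|k _].
  by case: ifP => // _; rewrite lee_fin.
pose g (m : nat) : \bar R := if (1 < m)%N then m%:R%:E else 0%E.
move=> _ B mB; rewrite setTI.
exact: (discrete_preimage (g @^-1` B) (discrete_Lambda n k i)).
Qed.

(** The comparisons between the first [n] strings determine which of them is
    the [l]-th smallest. *)
Lemma order_stat_index n l : exists2 idx : Omega -> nat,
  discrete_rv idx & forall om, order_stat (S^~ om) n l = S (idx om) om.
Proof.
pose cmp om := [seq [seq (S i om <= S j om)%O | j <- iota 0 n] | i <- iota 0 n].
pose r (a : seq (seq bool)) (i j : 'I_n) := nth false (nth [::] a i) j.
pose rank a := nth 0%N [seq val i | i <- sort (r a) (enum 'I_n)] l.-1.
exists (fun om => rank (cmp om)).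
  apply: (discrete_comp rank); apply: discrete_map => i; apply: discrete_map => j.
  by apply: discrete_bool; exact: measurable_le.
move=> om; have rE : r (cmp om) = relpre (fun i : 'I_n => S i om) <=%O.
  apply/funext => i; apply/funext => j; rewrite /r /cmp /=.
  by rewrite !(nth_map 0%N) ?size_iota// !nth_iota.
rewrite /order_stat /mkseq -val_enum_ord -map_comp sort_map /rank rE.
set t := sort _ _; have [lt|tl] := ltnP l.-1 (size t).
  case: t lt => // i0 t lt.
  by rewrite (nth_map i0)// (nth_map i0).
by rewrite !nth_default// size_map.
Qed.

(** [Zn] is a finite sum of natural numbers, or infinite because all its terms
    are at least 2. *)
Lemma fine_Zn_nat (s : nat -> istring b) n v :
  exists m : nat, fine (Zn R s n v) = m%:R.
Proof.
pose f k : \bar R := if (1 < Lambda s n k v)%N then (Lambda s n k v)%:R%:E else 0%E.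
pose fn k : nat := if (1 < Lambda s n k v)%N then Lambda s n k v else 0%N.
have fE k : f k = (fn k)%:R%:E by rewrite /f /fn; case: ifP.
have f0 k : (0 <= f k)%E by rewrite fE lee_fin.
have Lmono i k : (i <= k)%N -> (Lambda s n k v <= Lambda s n i v)%N.
  move=> ik; rewrite !LambdaE; apply: sub_count => j /= /eqP vs.
  by apply/eqP; exact: mkseq_eqW vs.
have [[K LK]|nK] := pselect (exists K, (Lambda s n K v <= 1)%N).
  exists (\sum_(0 <= k < K) fn k)%N.
  rewrite /Zn (nneseries_split 0 K) => [|k _]; last exact: f0.
  rewrite add0n [X in (_ + X)%E]eseries0 => [|k Kk _]; last first.
    by rewrite ltnNge (leq_trans (Lmono _ _ Kk) LK).
  rewrite adde0 (eq_bigr (fun k => (fn k)%:R%:E)) => [|k _]; last exact: fE.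
  by rewrite sumEFin /= natr_sum.
exists 0%N; rewrite [Zn _ _ _ _](_ : _ = +oo%E)//; apply/eqyP => A A0.
apply: (@le_trans _ _ (\sum_(0 <= k < (Num.truncn A).+1) f k)%E); last first.
  by apply: nneseries_lim_ge => k _ _; exact: f0.
apply: (@le_trans _ _ (\sum_(0 <= k < (Num.truncn A).+1) 1%:E)%E).
  rewrite sumEFin lee_fin sumr_const_nat subn0.
  exact/ltW/truncnS_gt.
apply: lee_sum => k _; rewrite fE lee_fin ler1n /fn.
by case: ifP => [/ltnW//|/negbT]; rewrite -leqNgt => Lk; case: nK; exists k.
Qed.

Lemma truncn_Yn (s : nat -> istring b) n l :
  (Num.truncn (Yn R s n l))%:R = Yn R s n l.
Proof.
rewrite /Yn; set v := order_stat _ _ _.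
by have [m ->] := fine_Zn_nat s n v; rewrite natrK.
Qed.

Lemma discrete_Yn n l : discrete_rv (fun om => Num.truncn (Yn R (S^~ om) n l)).
Proof.
rewrite /Yn; set l' := (if _ then _ else _).
have [idx midx idxE] := order_stat_index n l'.
move=> m; rewrite (_ : [set _ | _] = \bigcup_i ([set om | idx om = i] `&`
    [set om | fine (Zn R (S^~ om) n (S i om)) = m%:R])).
  apply: bigcupT_measurable => i; apply: measurableI; first exact: midx.
  have mf : measurable_fun setT (fun om => fine (Zn R (S^~ om) n (S i om))).
    exact: measurableT_comp (measurable_Zn n i).
  by have := mf measurableT [set m%:R] (measurable_set1 _); rewrite setTI.
apply/seteqP; split=> [om /=|om [i _ [/= <-]]].
  rewrite idxE; have [m' E] := fine_Zn_nat (S^~ om) n (S (idx om) om).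
  by rewrite E natrK => <-; exists (idx om).
by rewrite idxE => ->; rewrite natrK.
Qed.

End measurability.

Section process.
Context (R : realType) (b : nat) (b_gt1 : (1 < b)%N).
Variables (mu : 'I_b -> R) (p : 'I_b -> 'I_b -> R).
Context d (Omega : measurableType d) (P : probability Omega R).
Variable S : nat -> Omega -> istring b.
Hypothesis mS : forall i, random_string (S i).

Lemma to_skorokhod_ext (c e : R) (f g : R -> R) : {in `[c, e], f =1 g} ->
  to_skorokhod c e f = to_skorokhod c e g.
Proof.
move=> fg; rewrite /to_skorokhod; congr insubd; apply/funext => t.
by case: ifP => // /fg.
Qed.

(** Only countably many paths are possible, so that the preimage of any set is
    a countable union of events. *)
Lemma measurable_calY (c e : R) n (K : set (skorokhod c e)) : 0 <= c -> e <= 1 ->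
  measurable ((fun om => to_skorokhod c e (calY P b_gt1 mu p S n om)) @^-1` K).
Proof.
move=> c0 e1.
pose V om := [seq Num.truncn (Yn R (S^~ om) n l) | l <- iota 0 n.+2].
pose G (y : seq nat) t : R := ((nth 0%N y (Num.truncn (t * n%:R)).+1)%:R
   - m_fun mu p (h_fun b_gt1 (Defs.cdf P (S 0%N)) t) * n%:R) / Num.sqrt n%:R.
have mV : discrete_rv V by apply: discrete_map => l; exact: discrete_Yn.
rewrite (_ : _ @^-1` K = V @^-1` [set y | K (to_skorokhod c e (G y))]).
  exact: discrete_preimage.
apply/funext => om /=; congr K; apply: to_skorokhod_ext => t.
rewrite in_itv /= => /andP[ct te]; rewrite /calY /G /V.
have t0 : 0 <= t by exact: le_trans ct.
have tn : (Num.truncn (t * n%:R) < n.+1)%N.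
  rewrite ltnS -(ler_nat R).
  apply: (@le_trans _ _ (t * n%:R)); first by rewrite truncn_le mulr_ge0.
  by rewrite ler_piMl// (le_trans te).
rewrite (nth_map 0%N) ?size_iota// nth_iota// add0n.
by rewrite truncn_Yn.
Qed.

End process.

(** * Non-tightness *)

Section paths.
Context (R : realType) (b : nat) (b_gt1 : (1 < b.+2)%N).
Variables (mu : 'I_b.+2 -> R) (p : 'I_b.+2 -> 'I_b.+2 -> R).
Context d0 (Omega : measurableType d0) (P : probability Omega R).
Variable S : nat -> Omega -> istring b.+2.
Hypothesis src : source_params mu p.
Hypothesis mc : forall i, is_markov_chain P mu p (S i).
Variables c d : R.
Hypotheses (c_ge0 : 0 <= c) (d_le1 : d <= 1).
Notation mh := (fun t => m_fun mu p (h_fun b_gt1 (Defs.cdf P (S 0%N)) t)).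
Notation Y := (calY P b_gt1 mu p S).

Lemma calY_cadlag n om : cadlag c d (Y n om).
Proof.
have [rho rho01 step_le] := step_bound src.
apply: cadlag_lin; first exact: (cadlag_truncn _ (fun m => Yn R (S^~ om) n m.+1)).
by apply: (mh_cadlag src rho01 step_le) => // w k; exact: cdf_bounds.
Qed.

Variables (t0 ml : R).
Hypotheses (ct0 : c < t0 < d) (mh_lim : mh x @[x --> t0^'-] --> ml).

(** The values of the path at [t0] and [t0 - n^-1] involve two neighbouring
    ranks, but the centerings differ by almost [(mh t0 - ml) * n]. A bound [M]
    on the path allows the numbers of bucket operations to deviate from the
    centerings by a multiple of the square root of n only. *)
Lemma neighbour_ranks_apart (M : R) : mh t0 != ml ->
  exists n0, forall n, (n0 <= n)%N -> forall om,
    (forall t, t \in `[c, d] -> `|Y n om t| <= M) ->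
    let l := Num.truncn (t0 * n%:R) in
    (0 < l < n)%N /\
    `|mh t0 - ml| / 2 * n%:R <= `|Yn R (S^~ om) n l.+1 - Yn R (S^~ om) n l|.
Proof.
move=> mh_ne; set D := `|mh t0 - ml|.
have D0 : 0 < D by rewrite normr_gt0 subr_eq0.
have /andP[ct td] := ct0.
have t0_gt0 : 0 < t0 by exact: le_lt_trans ct.
have t0_lt1 : t0 < 1 by exact: lt_le_trans d_le1.
have [eta eta0 etaP] : exists2 eta : R, 0 < eta & forall x, t0 - eta < x -> x < t0 ->
    `|ml - mh x| < D / 4.
  have /cvgrPdist_lt/(_ (D / 4)) : mh x @[x --> t0^'-] --> ml by [].
  rewrite divr_gt0// => /(_ isT); rewrite near_withinE => -[eta /= eta0 etaP].
  exists eta => // x xl xr; apply: etaP => //=.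
  by rewrite ger0_norm ?subr_ge0 ?ltW// ltrBlDr addrC -ltrBlDr.
(* The four entries make the point t0 - n^-1 lie near enough to t0 for the left
   limit, keep l positive, keep that point in [c, d], and make the allowed
   deviations M * sqrt n smaller than D / 8 * n. *)
pose a := Num.max (eta^-1) (Num.max (t0^-1) (Num.max ((t0 - c)^-1) ((8 * `|M| / D) ^+ 2))).
exists (Num.truncn a).+1 => n an om bM l.
have {an} an : a < n%:R by apply: lt_le_trans (truncnS_gt a) _; rewrite ler_nat.
have [a1 a2 a3 a4] : [/\ eta^-1 < n%:R, t0^-1 < n%:R, (t0 - c)^-1 < n%:R &
    (8 * `|M| / D) ^+ 2 < n%:R].
  by move: an; rewrite /a !gt_max => /and4P[].
have n0 : 0 < n%:R :> R by apply: lt_trans a2; rewrite invr_gt0.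
have tc : 0 < t0 - c by rewrite subr_gt0.
have inv_lt (x : R) : 0 < x -> x^-1 < n%:R -> n%:R^-1 < x.
  by move=> x0 xn; rewrite -[x]invrK ltf_pV2 ?posrE ?invr_gt0.
have n1 : n%:R^-1 < eta by exact: inv_lt.
have n2 : n%:R^-1 < t0 by exact: inv_lt.
have n3 : n%:R^-1 < t0 - c by exact: inv_lt.
have tn1 : 1 < t0 * n%:R by rewrite mulrC -ltr_pdivrMr// div1r.
have l_gt0 : (0 < l)%N by rewrite truncn_gt0 ltW.
have l_ltn : (l < n)%N.
  by rewrite truncn_lt_nat ?mulr_ge0 ?ltW// gtr_pMl.
split; first by rewrite l_gt0.
set t1 := t0 - n%:R^-1.
have t1n : Num.truncn (t1 * n%:R) = l.-1.
  have /andP[l1 l2] := truncn_itv (ltW (mulr_gt0 t0_gt0 n0)).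
  rewrite -/l in l1 l2; apply: truncn_def.
  rewrite /t1 mulrBl mulVf ?lt0r_neq0// prednK// lerBrDr ltrBlDr !natr1.
  by rewrite prednK// l1.
have cd0 : t0 \in `[c, d] by rewrite in_itv /= !ltW.
have cd1 : t1 \in `[c, d].
  rewrite in_itv /= /t1; apply/andP; split; first lra.
  by rewrite (le_trans _ (ltW td))// gerBl invr_ge0 ltW.
have := bM _ cd0; have := bM _ cd1; rewrite /calY t1n prednK// -/l.
set y1 := Yn _ _ _ l; set y2 := Yn _ _ _ l.+1 => b1 b2.
have sq0 : 0 < Num.sqrt n%:R :> R by rewrite sqrtr_gt0.
have sqV : `|(Num.sqrt n%:R)^-1| = (Num.sqrt n%:R)^-1 :> R.
  by rewrite ger0_norm// invr_ge0 ltW.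
rewrite normrM sqV ler_pdivrMr// in b1.
rewrite normrM sqV ler_pdivrMr// in b2.
have Mn : M * Num.sqrt n%:R <= D / 8 * n%:R.
  have e : n%:R = Num.sqrt n%:R * Num.sqrt n%:R :> R by rewrite -expr2 sqr_sqrtr// ltW.
  rewrite [in leRHS]e mulrA ler_wpM2r ?(ltW sq0)//.
  have : 8 * `|M| / D <= Num.sqrt n%:R.
    have x0 : 0 <= 8 * `|M| / D by rewrite mulr_ge0 ?mulr_ge0// invr_ge0 ltW.
    by rewrite -ler_sqr ?nnegrE ?(ltW sq0)// sqr_sqrtr ltW.
  rewrite ler_pdivrMr// => h; have := ler_norm M; lra.
have := etaP t1; rewrite /t1 ltrD2l ltrN2 n1 gtrBl invr_gt0 n0 => /(_ isT isT) e1.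
rewrite -/t1 in e1.
have DD : D <= `|mh t0 - mh t1| + D / 4.
  apply: le_trans (ler_distD (mh t1) _ _) _; rewrite lerD2l.
  by rewrite distrC ltW.
have Dn : D * n%:R <= `|mh t0 * n%:R - mh t1 * n%:R| + D / 4 * n%:R.
  by rewrite -mulrBl normrM (ger0_norm (ltW n0)) -mulrDl ler_pM2r.
have d1 := ler_distD y2 (mh t0 * n%:R) (mh t1 * n%:R).
have d2 := ler_distD y1 y2 (mh t1 * n%:R).
rewrite distrC in b2; lra.
Qed.

End paths.

Lemma fourth_root (R : realType) (rho : R) : 0 < rho < 1 ->
  exists2 th : R, 0 < th < 1 & rho = th ^+ 4.
Proof.
move=> /andP[r0 r1]; exists (Num.sqrt (Num.sqrt rho)).
  by rewrite !sqrtr_gt0 r0 -[ltRHS]sqrtr1 ltr_sqrt// -[ltRHS]sqrtr1 ltr_sqrt.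
by rewrite (exprM _ 2 2) !sqr_sqrtr ?sqrtr_ge0// ltW.
Qed.

Section nontight.
Context (R : realType) (b : nat) (b_gt1 : (1 < b.+2)%N).
Variables (mu : 'I_b.+2 -> R) (p : 'I_b.+2 -> 'I_b.+2 -> R).
Context d0 (Omega : measurableType d0) (P : probability Omega R).
Variable S : nat -> Omega -> istring b.+2.
Hypothesis src : source_params mu p.
Hypothesis mc : forall i, is_markov_chain P mu p (S i).
Hypothesis indep : independent_strings P S.

Lemma prob_setC_le (A : set Omega) (e : R) : measurable A ->
  ((1 - e)%:E <= P A)%E -> (P (~` A) <= e%:E)%E.
Proof.
move=> mA; rewrite probability_setC//.
rewrite -[P A]fineK ?fin_num_measure// -EFinB !lee_fin => h; lra.
Qed.

(** Suppose that all paths lie in one compact set with probability [1 - e]; then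
    they are uniformly bounded. If no word of length at least [K] is the prefix
    of too many strings, the two order statistics with ranks next to [t0 * n]
    must differ within the first [K] letters, which determines the rank from a
    prefix of length [K]. The exceptional events for the sample sizes [n],
    [n + k], ..., [n + N * k] have a smaller total probability than the event
    [H n], whose probability does not depend on [n]. At some point of [H n] none
    of them occurs, in contradiction to [prefix_pigeonhole]. *)
Lemma not_tight_of_jump (c d t0 ml : R) : 0 <= c -> d <= 1 -> c < t0 < d ->
  m_fun mu p (h_fun b_gt1 (Defs.cdf P (S 0%N)) x) @[x --> t0^'-] --> ml ->
  m_fun mu p (h_fun b_gt1 (Defs.cdf P (S 0%N)) t0) != ml ->
  ~ tight P (fun n om => to_skorokhod c d (calY P b_gt1 mu p S n om)).
Proof.
move=> c0 d1 ct0 mh_lim mh_ne tght; have /andP[ct td] := ct0.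
set D := `|m_fun mu p (h_fun b_gt1 (Defs.cdf P (S 0%N)) t0) - ml|.
have D_gt0 : 0 < D by rewrite normr_gt0 subr_eq0.
have t0_gt0 : 0 < t0 by exact: le_lt_trans ct.
have [rho rho01 step_le] := step_bound src.
have [th th01 rhoE] := fourth_root rho01; rewrite rhoE in step_le.
have /andP[th0 th1] := th01; have th1' : 0 < 1 - th by rewrite subr_gt0.
have [K Kcond] : exists K, expR 1 * th ^+ K <= Num.min (2^-1) (D / 4 * (1 - th)).
  by apply: expR_th_small; rewrite // lt_min invr_gt0 ltr0n mulr_gt0// divr_gt0.
have [K2 KD] : expR 1 * th ^+ K <= 2^-1 /\ th ^+ K / (1 - th) < D / 2.
  move: Kcond; rewrite le_min => /andP[-> K1]; split=> //.
  rewrite ltr_pdivrMr//; have e1 := expR_ge1Dx (1 : R).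
  have : th ^+ K <= expR 1 * th ^+ K by rewrite ler_peMl ?exprn_ge0 ?ltW//; lra.
  have : 0 < D * (1 - th) by rewrite mulr_gt0.
  lra.
(* Two of the N + 1 sample sizes below have to share a boundary. *)
have [N bN] : exists N, (b.+2 ^ K <= N)%N by exists (b.+2 ^ K)%N.
pose k := (Num.truncn t0^-1).+1.
(* Adding k strings raises the rank next to t0 * n. *)
have kt0 : 1 < t0 * k%:R by rewrite mulrC -ltr_pdivrMr// div1r truncnS_gt.
pose top : istring b.+2 := fun=> ord_max.
pose J n := iota n (N * k).
pose H n := \big[setI/setT]_(i <- J n) [set om | mkseq (S i om) K = mkseq top K].
pose h := weight mu p top K ^+ (N * k).
have h0 : 0 < h by rewrite exprn_gt0// (weight_gt0 src).
have PH n : P (H n) = h%:E.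
  by rewrite /H (prob_common_prefix mc indep) ?iota_uniq// size_iota.
(* The N + 1 sample sizes contribute two bad events each, of probability at most
   e; this makes up half of the probability of H n. *)
pose e := h / (4 * N.+1%:R).
have e0 : 0 < e by rewrite divr_gt0// mulr_gt0// ltr0n.
have [C Ccpt PC] := tght e e0.
have [M CM] := compact_skorokhod_bounded Ccpt.
have [n1 deep_le] := prob_deep_crowd_cvg0 src mc indep th01 step_le K2 e0.
have [n2 apart] := neighbour_ranks_apart c0 d1 ct0 mh_lim M mh_ne.
pose n := (maxn n1 n2).+1; pose nj j := (n + j * k)%N.
have n_nj j : (maxn n1 n2 <= nj j)%N by rewrite /nj /n addSn leqW// leq_addr.
have mS i : random_string (S i) by exact: markov_random_string (mc i).
pose X m om := to_skorokhod c d (calY P b_gt1 mu p S m om).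
pose bad j := ~` (X (nj j) @^-1` C) `|` deep_crowd S th (nj j) K.
have mX m : measurable (X m @^-1` C) by exact: measurable_calY.
have mdeep m : measurable (deep_crowd S th m K) by exact: (measurable_deep_crowd mc).
have mbad j : measurable (bad j) by apply: measurableU => //; exact: measurableC.
have Pbad j : (P (bad j) <= (e + e)%:E)%E.
  apply: le_trans (measureU2 _ _ _) _ => //; first exact: measurableC.
  rewrite EFinD; apply: leeD.
    by apply: prob_setC_le => //; apply: PC; rewrite /nj /n addSn.
  by apply: deep_le; rewrite (leq_trans _ (n_nj j))// leq_maxl.
have mH : measurable (H n).
  by apply: bigsetI_measurable => i _; exact: measurable_prefix.
have HU : H n `<=` \big[setU/set0]_(0 <= j < N.+1) bad j.
  move=> om Hom; rewrite -bigcup_seq; apply: contrapT => nbad.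
  have good j : (j <= N)%N -> C (X (nj j) om) /\ ~ deep_crowd S th (nj j) K om.
    move=> jN; split.
      apply: contrapT => nC; apply: nbad; exists j; first by rewrite /= mem_index_iota.
      by left.
    by move=> dc; apply: nbad; exists j; [rewrite /= mem_index_iota|right].
  pose l j := Num.truncn (t0 * (nj j)%:R).
  apply: (@prefix_pigeonhole _ (S^~ om) (fun j => order_stat (S^~ om) (nj j) (l j))
    (fun j => order_stat (S^~ om) (nj j) (l j).+1) l K N n k bN).
  - move=> i /andP[ni iN] j jK.
    have : [set om | mkseq (S i om) K = mkseq top K] om.
      by move: Hom; rewrite /H -bigcap_seq; apply; rewrite /= mem_iota ni iN.
    by move=> /= /mkseq_eqP/(_ j jK) ->.
  - move=> j jN; have [Cj ndeep] := good j jN.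
    have [] := apart (nj j) _ om.
    + by rewrite (leq_trans _ (n_nj j))// leq_maxr.
    + move=> t tcd; have := CM _ Cj t tcd; rewrite /X to_skorokhodE//.
      exact: calY_cadlag.
    rewrite -/(l j) => /[dup] lj /andP[_ lj2] far.
    apply: count_order_stat => // same.
    have few k' v : (K <= k')%N ->
        (Lambda (S^~ om) (nj j) k' v < crowd th (nj j) k')%N.
      move=> Kk; rewrite ltnNge; apply/negP => cr; apply: ndeep.
      by exists (k' - K)%N => //; rewrite subnKC//; exists v.
    have close := Zn_close th01 few same; rewrite distrC in close.
    have Ylt m : (m <= nj j)%N ->
        Yn R (S^~ om) (nj j) m = fine (Zn R (S^~ om) (nj j) (order_stat (S^~ om) (nj j) m)).
      by move=> mn; rewrite /Yn ltn_eqF// ltnS.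
    rewrite !Ylt// 1?ltnW// in far.
    have nj0 : 0 < (nj j)%:R :> R by rewrite ltr0n /nj /n addSn.
    have := le_trans far close; rewrite -[leRHS]mulrA [leRHS]mulrC ler_pM2r//.
    by rewrite leNgt KD.
  - have lmono i j : (i < j)%N -> (l i < l j)%N.
      move=> ij; rewrite /l truncn_gt_nat -natr1.
      apply: (@le_trans _ _ (t0 * (nj i)%:R + t0 * k%:R)).
        by rewrite lerD ?(ltW kt0)// truncn_le mulr_ge0// ltW.
      rewrite -mulrDr -natrD ler_pM2l// ler_nat /nj -addnA leq_add2l addnC -mulSn.
      by rewrite leq_mul2r ij orbT.
    move=> i j _ _ lij; have [ij|ji|//] := ltngtP i j.
      by have := lmono _ _ ij; rewrite lij ltnn.
    by have := lmono _ _ ji; rewrite lij ltnn.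
have : (h%:E <= (\sum_(0 <= j < N.+1) (e + e))%:E)%E.
  rewrite -(PH n) -sumEFin.
  apply: (@le_trans _ _ (P (\big[setU/set0]_(0 <= j < N.+1) bad j))).
    by apply: le_measure; rewrite ?inE//; exact: bigsetU_measurable.
  apply: le_trans (prob_bigsetU_le _ _ _ _) _ => //.
  by apply: lee_sum => j _; exact: Pbad.
have N0 : 0 < N.+1%:R :> R by rewrite ltr0n.
have e4 : e * N.+1%:R = h / 4 by rewrite /e invfM mulrA divfK ?lt0r_neq0.
rewrite lee_fin sumr_const_nat subn0 -mulr_natr mulrDl e4; lra.
Qed.

End nontight.

Theorem corollary2p11 (R : realType) (b : nat) (b_gt1 : (1 < b)%N)
    (mu : 'I_b -> R) (p : 'I_b -> 'I_b -> R)
    (d0 : measure_display) (Omega : measurableType d0)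
    (P : probability Omega R) (S : nat -> Omega -> istring b) (c d : R) :
  source_params mu p ->
  (forall i, is_markov_chain P mu p (S i)) ->
  independent_strings P S ->
  ~ (exists2 beta : R, 0 < beta & geometric_rows p beta) ->
  0 <= c -> c < d -> d <= 1 ->
  ~ tight P (fun n om => to_skorokhod c d (calY P b_gt1 mu p S n om)).
Proof.
case: b b_gt1 mu p S => [//|[//|b]] b_gt1 mu p S src mc indep ngeo c0 cd d1.
have [rho rho01 step_le] := step_bound src.
have [t0 ct0 [ml mh_lim mh_ne]] :=
  mh_jump src rho01 step_le b_gt1 (fun w k => cdf_bounds w k (mc 0%N)) c0 cd d1 ngeo.
exact: not_tight_of_jump mh_lim mh_ne.
Qed.
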